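(* Let $X$ be a scheme and let $0 \rightarrow \mathscr{F}\stackrel{\tau}{\to} \mathscr{G}$ be an exact sequence of $\mathcal{O}_X$-modules. The following conditions are equivalent: 1. The sequence is pure exact. 2. For each $x\in X$ the monomorphism $0 \rightarrow \mathscr{F}_x\stackrel{\tau_x}{\to} \mathscr{G}_x$ of $\mathcal{O}_{X,x}$-modules is pure.
   Context: An exact sequence $0\to\mathscr{F}\stackrel{\tau}{\to}\mathscr{G}$ of (arbitrary) $\mathcal{O}_X$-modules is pure exact if, for each $\mathcal{O}_X$-module $\mathscr{M}$, the induced sequence $0\to\mathscr{M}\otimes\mathscr{F}\stackrel{id\otimes\tau}{\longrightarrow}\mathscr{M}\otimes\mathscr{G}$ is exact, where $\otimes$ is the tensor product of sheaves of $\mathcal{O}_X$-modules. For a commutative ring $R$, a monomorphism $L\to M$ of $R$-modules is pure if $T\otimes_R L\to T\otimes_R M$ is injective for every $R$-module $T$. *)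

(* Defs.v *)
From HB Require Import structures.
From mathcomp Require Import all_boot all_algebra generic_quotient.
From mathcomp Require Import boolp classical_sets functions.
From mathcomp Require Import topology_structure subtype_topology.
From mathcomp Require Import ring.

Set Implicit Arguments.
Unset Strict Implicit.
Unset Printing Implicit Defensive.

Import GRing.Theory.
Local Open Scope classical_set_scope.
Local Open Scope quotient_scope.
Local Open Scope ring_scope.

(* Rings are [comPzRingType]s: commutative with 1, the zero ring being allowed
   (it is the ring of sections over the empty set). *)

Section PropQuotient.
Context (T : choiceType) (R : T -> T -> Prop).
Hypothesis Rrefl : forall x, R x x.
Hypothesis Rsym : forall x y, R x y -> R y x.
Hypothesis Rtrans : forall x y z, R x y -> R y z -> R x z.

Let r (x y : T) : bool := `[< R x y >].

Let r_refl : reflexive r. Proof. by move=> x; apply/asboolP. Qed.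

Let r_sym : symmetric r.
Proof. by move=> x y; apply/asboolP/asboolP => /Rsym. Qed.

Let r_trans : transitive r.
Proof. by move=> y x z /asboolP xy /asboolP yz; apply/asboolP/(Rtrans xy). Qed.

Definition prop_equiv : equiv_rel T := EquivRel r r_refl r_sym r_trans.

Lemma prop_eqmodP (x y : T) :
  (\pi_({eq_quot prop_equiv}) x = \pi_({eq_quot prop_equiv}) y) <-> R x y.
Proof.
by split => [/eqmodP/asboolP//|xy]; apply/eqmodP/asboolP.
Qed.

End PropQuotient.

Section TensorProduct.
Context {R : comPzRingType}.
Implicit Types M N : lmodType R.

(* The list [:: (m1, n1); ...; (mk, nk)] stands for m1 (x) n1 + ... + mk (x) nk;
   [tensor_rel] is the congruence generated by bilinearity. *)
Inductive tensor_rel M N : seq (M * N) -> seq (M * N) -> Prop :=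
| tensor_refl s : tensor_rel s s
| tensor_sym s t : tensor_rel s t -> tensor_rel t s
| tensor_trans s t u : tensor_rel s t -> tensor_rel t u -> tensor_rel s u
| tensor_cat s s' t t' :
    tensor_rel s s' -> tensor_rel t t' -> tensor_rel (s ++ t) (s' ++ t')
| tensor_comm s t : tensor_rel (s ++ t) (t ++ s)
| tensor_addl m m' n : tensor_rel [:: (m + m', n)] [:: (m, n); (m', n)]
| tensor_addr m n n' : tensor_rel [:: (m, n + n')] [:: (m, n); (m, n')]
| tensor_scale (a : R) m n : tensor_rel [:: (a *: m, n)] [:: (m, a *: n)]
| tensor_zero n : tensor_rel [:: (0, n)] [::].

Definition tensor_equiv M N : equiv_rel (seq (M * N)) :=
  prop_equiv (@tensor_refl M N) (@tensor_sym M N) (@tensor_trans M N).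

Definition tensor M N : Type := {eq_quot (tensor_equiv M N)}.

HB.instance Definition _ M N := Choice.copy (tensor M N) {eq_quot (tensor_equiv M N)}.

Definition tsum M N (s : seq (M * N)) : tensor M N :=
  \pi_({eq_quot (tensor_equiv M N)}) s.

Definition tprod M N (m : M) (n : N) : tensor M N := tsum [:: (m, n)].

Definition trepr M N (t : tensor M N) : seq (M * N) :=
  repr (t : {eq_quot (tensor_equiv M N)}).

Lemma treprK M N (t : tensor M N) : tsum (trepr t) = t.
Proof. exact: reprK. Qed.

Lemma tsum_eq M N (s t : seq (M * N)) : tsum s = tsum t <-> tensor_rel s t.
Proof. exact: prop_eqmodP. Qed.

Lemma trepr_rel M N (s : seq (M * N)) : tensor_rel (trepr (tsum s)) s.
Proof. by apply/tsum_eq; rewrite treprK. Qed.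

End TensorProduct.

Section TensorMap.
Context {R S : comPzRingType} (phi : R -> S).
Context {M N : lmodType R} {M' N' : lmodType S}.

Definition tmap_seq (f : M -> M') (g : N -> N') (s : seq (M * N)) :=
  [seq (f p.1, g p.2) | p <- s].

(* The map f (x) g, meaningful when f and g are additive and semilinear with
   respect to the same ring morphism. *)
Definition tensor_map (f : M -> M') (g : N -> N') (t : tensor M N) :
    tensor M' N' :=
  tsum (tmap_seq f g (trepr t)).

Variables (f : {additive M -> M'}) (g : {additive N -> N'}).
Hypothesis fZ : forall a m, f (a *: m) = phi a *: f m.
Hypothesis gZ : forall a m, g (a *: m) = phi a *: g m.

Lemma tensor_rel_map s t :
  tensor_rel s t -> tensor_rel (tmap_seq f g s) (tmap_seq f g t).
Proof.
rewrite /tmap_seq; elim=> {s t} /=.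
- by move=> s; exact: tensor_refl.
- by move=> s t _; exact: tensor_sym.
- by move=> s t u _ ? _; exact: tensor_trans.
- by move=> s s' t t' _ ? _ ?; rewrite !map_cat; exact: tensor_cat.
- by move=> s t; rewrite !map_cat; exact: tensor_comm.
- by move=> m m' n; rewrite raddfD; exact: tensor_addl.
- by move=> m n n'; rewrite raddfD; exact: tensor_addr.
- by move=> a m n; rewrite fZ gZ; exact: tensor_scale.
- by move=> n; rewrite raddf0; exact: tensor_zero.
Qed.

Lemma tensor_map_sum s : tensor_map f g (tsum s) = tsum (tmap_seq f g s).
Proof. by apply/tsum_eq/tensor_rel_map/trepr_rel. Qed.

End TensorMap.

Section TensorModule.
Context {R : comPzRingType} (M N : lmodType R).
Implicit Types t u v : tensor M N.

Definition tensor_0 : tensor M N := tsum [::].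
Definition tensor_add t u : tensor M N := tsum (trepr t ++ trepr u).
Definition tensor_mul (a : R) : tensor M N -> tensor M N :=
  tensor_map ( *:%R a) idfun.
Definition tensor_opp : tensor M N -> tensor M N := tensor_mul (-1).

Lemma tsumD s s' : tensor_add (tsum s) (tsum s') = tsum (s ++ s').
Proof. by apply/tsum_eq/tensor_cat; exact: trepr_rel. Qed.

Lemma tsumZ a s :
  tensor_mul a (tsum s) = tsum [seq (a *: p.1, p.2) | p <- s].
Proof.
rewrite /tensor_mul (@tensor_map_sum _ _ id _ _ _ _ ( *:%R a) idfun) //.
by move=> b m /=; rewrite !scalerA mulrC.
Qed.

Lemma tensor_addA : associative tensor_add.
Proof.
move=> t u v; rewrite -(treprK t) -(treprK u) -(treprK v).
by rewrite !tsumD catA.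
Qed.

Lemma tensor_addC : commutative tensor_add.
Proof. by move=> t u; apply/tsum_eq/tensor_comm. Qed.

Lemma tensor_add0 : left_id tensor_0 tensor_add.
Proof. by move=> t; rewrite -(treprK t) tsumD. Qed.

Lemma tensor_addN : left_inverse tensor_0 tensor_opp tensor_add.
Proof.
move=> t; rewrite -(treprK t) /tensor_opp tsumZ.
have addACA a b c d : tensor_add (tensor_add a b) (tensor_add c d) =
    tensor_add (tensor_add a c) (tensor_add b d).
  rewrite -(tensor_addA a b) -(tensor_addA a c); congr tensor_add.
  by rewrite (tensor_addA b c) (tensor_addC b c) -(tensor_addA c b).
elim: (trepr t) => [|[m n] s IH]; first by rewrite tsumD.
rewrite map_cons -(cat1s (m, n)) -(cat1s (_, _) (map _ _)) -!tsumD addACA IH.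
rewrite !tsumD cats0; apply/tsum_eq.
apply: tensor_trans (tensor_sym (tensor_addl _ _ _)) _.
by rewrite scaleN1r addNr; exact: tensor_zero.
Qed.

HB.instance Definition _ := GRing.isZmodule.Build (tensor M N)
  tensor_addA tensor_addC tensor_add0 tensor_addN.

Lemma tsum_cat (s s' : seq (M * N)) : tsum (s ++ s') = tsum s + tsum s'.
Proof. by rewrite -tsumD. Qed.

Lemma tsum_nil : tsum [::] = 0 :> tensor M N. Proof. by []. Qed.

Lemma tsum_cons m n (s : seq (M * N)) : tsum ((m, n) :: s) = tprod m n + tsum s.
Proof. by rewrite -cat1s tsum_cat. Qed.

Lemma tprodDl m m' n : tprod (m + m') n = tprod m n + tprod m' n :> tensor M N.
Proof. by rewrite -tsum_cat; apply/tsum_eq/tensor_addl. Qed.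

Lemma tprodDr m n n' : tprod m (n + n') = tprod m n + tprod m n' :> tensor M N.
Proof. by rewrite -tsum_cat; apply/tsum_eq/tensor_addr. Qed.

Lemma tprodZ a m n : tprod (a *: m) n = tprod m (a *: n) :> tensor M N.
Proof. by apply/tsum_eq/tensor_scale. Qed.

Lemma tensor_ind (P : tensor M N -> Prop) :
  P 0 -> (forall m n t, P t -> P (tprod m n + t)) -> forall t, P t.
Proof.
move=> P0 PS t; rewrite -(treprK t).
by elim: (trepr t) => [|[m n] s IH] //; rewrite tsum_cons; exact: PS.
Qed.

Lemma tensor_mulprod a m n : tensor_mul a (tprod m n) = tprod (a *: m) n.
Proof. by rewrite tsumZ. Qed.

Lemma tensor_mulDr a : {morph tensor_mul a : t u / t + u}.
Proof.
move=> t u; rewrite -(treprK t) -(treprK u) -tsum_cat !tsumZ map_cat.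
by rewrite tsum_cat.
Qed.

Lemma tensor_mulA a b t : tensor_mul a (tensor_mul b t) = tensor_mul (a * b) t.
Proof.
rewrite -(treprK t) !tsumZ -map_comp; congr tsum; apply: eq_map => p /=.
by rewrite scalerA.
Qed.

Lemma tensor_mul1 : left_id 1 tensor_mul.
Proof.
move=> t; rewrite -(treprK t) tsumZ -[in RHS](map_id (trepr t)); congr tsum.
by apply: eq_map => -[m n] /=; rewrite scale1r.
Qed.

Lemma tensor_mulDl t : {morph tensor_mul^~ t : a b / a + b}.
Proof.
move=> a b; elim/tensor_ind: t => [|m n t IH].
  by rewrite /= -tsum_nil !tsumZ /= tsum_nil addr0.
rewrite !tensor_mulDr !tensor_mulprod IH scalerDl tprodDl.
by rewrite addrACA.
Qed.

HB.instance Definition _ := GRing.Zmodule_isLmodule.Build R (tensor M N)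
  tensor_mulA tensor_mul1 tensor_mulDr tensor_mulDl.

Lemma tprodZl a m n : a *: tprod m n = tprod (a *: m) n :> tensor M N.
Proof. exact: tensor_mulprod. Qed.

End TensorModule.

Section TensorMapMorphism.
Context {R S : comPzRingType} (phi : R -> S).
Context {M N : lmodType R} {M' N' : lmodType S}.
Variables (f : {additive M -> M'}) (g : {additive N -> N'}).
Hypothesis fZ : forall a m, f (a *: m) = phi a *: f m.
Hypothesis gZ : forall a m, g (a *: m) = phi a *: g m.

Lemma tensor_map_prod m n : tensor_map f g (tprod m n) = tprod (f m) (g n).
Proof. by rewrite (tensor_map_sum fZ gZ). Qed.

Lemma tensor_mapD : {morph tensor_map f g : t u / t + u}.
Proof.
move=> t u; rewrite -(treprK t) -(treprK u) -tsum_cat.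
by rewrite !(tensor_map_sum fZ gZ) /tmap_seq map_cat tsum_cat.
Qed.

Lemma tensor_map0 : tensor_map f g 0 = 0.
Proof. by rewrite -tsum_nil (tensor_map_sum fZ gZ). Qed.

Lemma tensor_map_additive : zmod_morphism (tensor_map f g).
Proof.
move=> t u; apply: (addIr (tensor_map f g u)).
by rewrite -tensor_mapD !subrK.
Qed.

Lemma tensor_mapZ a t : tensor_map f g (a *: t) = phi a *: tensor_map f g t.
Proof.
move: t; apply: tensor_ind => [|m n t IH].
  by rewrite scaler0 tensor_map0 scaler0.
by rewrite scalerDr !tensor_mapD scalerDr IH tprodZl !tensor_map_prod fZ tprodZl.
Qed.

End TensorMapMorphism.

Definition pure_mono {R : comPzRingType} {L M : lmodType R}
    (f : {linear L -> M}) : Prop :=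
  injective f /\
  forall T : lmodType R,
    injective (tensor_map idfun f : tensor T L -> tensor T M).

Record opens (X : topologicalType) := Opens {
  oset :> X -> Prop;
  oset_open : open (oset : set X)
}.

Definition opensI (X : topologicalType) (U V : opens X) : opens X :=
  @Opens X ((U : set X) `&` V) (openI (@oset_open X U) (@oset_open X V)).

Lemma opensIl (X : topologicalType) (U V : opens X) : opensI U V `<=` U.
Proof. by move=> x []. Qed.

Lemma opensIr (X : topologicalType) (U V : opens X) : opensI U V `<=` V.
Proof. by move=> x []. Qed.

Definition opens_preim (X Y : topologicalType) (f : X -> Y)
    (fc : continuous f) (V : opens Y) : opens X :=
  @Opens X (f @^-1` V) ((continuousP f).1 fc V (@oset_open Y V)).

Record presheaf (X : topologicalType) := Presheaf {
  psec :> opens X -> zmodType;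
  pres : forall U V : opens X, V `<=` U -> {additive psec U -> psec V};
  pres_id : forall (U : opens X) (h : U `<=` U) s, pres h s = s;
  pres_comp : forall (U V W : opens X)
    (hVU : V `<=` U) (hWV : W `<=` V) (hWU : W `<=` U) s,
    pres hWV (pres hVU s) = pres hWU s
}.
Arguments pres {X p U V} h.

Definition is_sheaf (X : topologicalType) (P : presheaf X) : Prop :=
  forall (V : opens X) (I : Type) (U : I -> opens X)
    (UV : forall i, U i `<=` V),
    (V `<=` \bigcup_i (U i : set X)) ->
  forall s : forall i, P (U i),
    (forall i j, pres (@opensIl X (U i) (U j)) (s i) =
                 pres (@opensIr X (U i) (U j)) (s j)) ->
  exists! t : P V, forall i, pres (UV i) t = s i.

Section Stalk.
Context {X : topologicalType}.
Implicit Types (P Q S : presheaf X) (x : X).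

Record pregerm P x := Pregerm {
  gdom : opens X;
  gmem : gdom x;
  gsec : P gdom
}.

HB.instance Definition _ P x := gen_eqMixin (pregerm P x).
HB.instance Definition _ P x := gen_choiceMixin (pregerm P x).

Definition germ_rel P x (g h : pregerm P x) : Prop :=
  exists (W : opens X) (hg : W `<=` gdom g) (hh : W `<=` gdom h),
    W x /\ pres hg (gsec g) = pres hh (gsec h).

Lemma germ_refl P x (g : pregerm P x) : germ_rel g g.
Proof.
by exists (gdom g), (@subset_refl _ _), (@subset_refl _ _); split; case: g.
Qed.

Lemma germ_sym P x (g h : pregerm P x) : germ_rel g h -> germ_rel h g.
Proof. by move=> [W [hg [hh [Wx e]]]]; exists W, hh, hg. Qed.

Lemma germ_trans P x (g h k : pregerm P x) :
  germ_rel g h -> germ_rel h k -> germ_rel g k.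
Proof.
move=> [W [Wg [Wh [Wx e]]]] [W' [W'h [W'k [W'x e']]]].
exists (opensI W W'), (subset_trans (@opensIl _ _ _) Wg),
  (subset_trans (@opensIr _ _ _) W'k); split=> //.
have WWh : opensI W W' `<=` gdom h := subset_trans (@opensIl _ _ _) Wh.
rewrite -(pres_comp Wg (@opensIl _ _ _)) e (pres_comp _ _ WWh).
by rewrite -(pres_comp W'k (@opensIr _ _ _)) -e' (pres_comp _ _ WWh).
Qed.

Definition germ_equiv P x : equiv_rel (pregerm P x) :=
  prop_equiv (@germ_refl P x) (@germ_sym P x) (@germ_trans P x).

Definition stalk P x : Type := {eq_quot (germ_equiv P x)}.

HB.instance Definition _ P x := Choice.copy (stalk P x) {eq_quot (germ_equiv P x)}.

Definition germ P x (U : opens X) (Ux : U x) (s : P U) : stalk P x :=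
  \pi_({eq_quot (germ_equiv P x)}) (Pregerm Ux s).

Definition stalk_repr P x (a : stalk P x) : pregerm P x :=
  repr (a : {eq_quot (germ_equiv P x)}).

Lemma stalk_reprK P x (a : stalk P x) :
  germ (gmem (stalk_repr a)) (gsec (stalk_repr a)) = a.
Proof. by rewrite -[RHS]reprK /germ -/(stalk_repr a); case: (stalk_repr a). Qed.

Lemma germ_eq P x (U V : opens X) (Ux : U x) (Vx : V x) (s : P U) (t : P V) :
  germ Ux s = germ Vx t <->
  exists (W : opens X) (WU : W `<=` U) (WV : W `<=` V),
    W x /\ pres WU s = pres WV t.
Proof. exact: prop_eqmodP. Qed.

Lemma germ_res P x (U V : opens X) (VU : V `<=` U) (Ux : U x) (Vx : V x)
  (s : P U) : germ Vx (pres VU s) = germ Ux s.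
Proof.
apply/germ_eq; exists V, (@subset_refl _ _), VU; split=> //.
exact: pres_id.
Qed.

Lemma germP P x (a : stalk P x) :
  exists (U : opens X) (Ux : U x) (s : P U), a = germ Ux s.
Proof.
by exists _, (gmem (stalk_repr a)), (gsec (stalk_repr a)); rewrite stalk_reprK.
Qed.

Lemma germP2 P Q x (a : stalk P x) (b : stalk Q x) :
  exists (U : opens X) (Ux : U x) (s : P U) (t : Q U),
    a = germ Ux s /\ b = germ Ux t.
Proof.
have [U [Ux [s ->]]] := germP a; have [V [Vx [t ->]]] := germP b.
exists (opensI U V), (conj Ux Vx), (pres (@opensIl _ _ _) s),
  (pres (@opensIr _ _ _) t).
by rewrite !(@germ_res _ _ _ (opensI U V)).
Qed.

Lemma germP3 P Q S x (a : stalk P x) (b : stalk Q x) (c : stalk S x) :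
  exists (U : opens X) (Ux : U x) (s : P U) (t : Q U) (u : S U),
    [/\ a = germ Ux s, b = germ Ux t & c = germ Ux u].
Proof.
have [U [Ux [s [t [-> ->]]]]] := germP2 a b.
have [V [Vx [u ->]]] := germP c.
exists (opensI U V), (conj Ux Vx), (pres (@opensIl _ _ _) s),
  (pres (@opensIl _ _ _) t), (pres (@opensIr _ _ _) u).
by rewrite !(@germ_res _ _ _ (opensI U V)).
Qed.

(* Only meaningful when [op] commutes with restriction, see the lemmas below. *)
Definition stalk_op1 P Q (op : forall U, P U -> Q U) x (a : stalk P x) :
    stalk Q x :=
  germ (gmem (stalk_repr a)) (op _ (gsec (stalk_repr a))).

Definition stalk_op2 P Q S (op : forall U, P U -> Q U -> S U) x
    (a : stalk P x) (b : stalk Q x) : stalk S x :=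
  let g := stalk_repr a in let h := stalk_repr b in
  @germ S x (opensI (gdom g) (gdom h)) (conj (gmem g) (gmem h))
    (op _ (pres (@opensIl _ _ _) (gsec g)) (pres (@opensIr _ _ _) (gsec h))).

Lemma stalk_op1E P Q (op : forall U, P U -> Q U) x
    (opN : forall (U V : opens X) (h : V `<=` U) s, pres h (op U s) = op V (pres h s))
    (U : opens X) (Ux : U x) s :
  stalk_op1 op (germ Ux s) = germ Ux (op U s).
Proof.
rewrite /stalk_op1; set g := stalk_repr _.
have /germ_eq[W [Wg [WU [Wx e]]]] : germ (gmem g) (gsec g) = germ Ux s.
  by rewrite stalk_reprK.
by apply/germ_eq; exists W, Wg, WU; split=> //; rewrite !opN e.
Qed.

Lemma stalk_op2E P Q S (op : forall U, P U -> Q U -> S U) x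
    (opN : forall (U V : opens X) (h : V `<=` U) s t,
      pres h (op U s t) = op V (pres h s) (pres h t))
    (U : opens X) (Ux : U x) s t :
  stalk_op2 op (germ Ux s) (germ Ux t) = germ Ux (op U s t).
Proof.
rewrite /stalk_op2; set g := stalk_repr (germ Ux s).
set h := stalk_repr (germ Ux t).
have /germ_eq[W [Wg [WU [Wx e]]]] : germ (gmem g) (gsec g) = germ Ux s.
  by rewrite stalk_reprK.
have /germ_eq[W' [W'h [W'U [W'x e']]]] : germ (gmem h) (gsec h) = germ Ux t.
  by rewrite stalk_reprK.
have WWg : opensI W W' `<=` gdom g := subset_trans (@opensIl _ _ _) Wg.
have WWh : opensI W W' `<=` gdom h := subset_trans (@opensIr _ _ _) W'h.
have WWU : opensI W W' `<=` U := subset_trans (@opensIl _ _ _) WU.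
apply/germ_eq; exists (opensI W W'), (fun y Wy => conj (WWg y Wy) (WWh y Wy)), WWU.
split=> //; rewrite !opN !(pres_comp _ _ WWg) !(pres_comp _ _ WWh); congr op.
  by rewrite -(pres_comp Wg (@opensIl _ _ _)) e; exact: pres_comp.
by rewrite -(pres_comp W'h (@opensIr _ _ _)) e'; exact: pres_comp.
Qed.

Section StalkZmod.
Context (P : presheaf X) (x : X).

Definition stalk_0 : stalk P x :=
  @germ P x (@Opens X setT openT) Logic.I 0.
Definition stalk_opp : stalk P x -> stalk P x :=
  @stalk_op1 P P (fun U => -%R) x.
Definition stalk_add : stalk P x -> stalk P x -> stalk P x :=
  @stalk_op2 P P P (fun U => +%R) x.

Let oppE (U : opens X) (Ux : U x) (s : P U) :
  stalk_opp (germ Ux s) = germ Ux (- s).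
Proof. by apply: stalk_op1E => *; rewrite raddfN. Qed.

Let addE (U : opens X) (Ux : U x) (s t : P U) :
  stalk_add (germ Ux s) (germ Ux t) = germ Ux (s + t).
Proof. by apply: stalk_op2E => *; rewrite raddfD. Qed.

Let zeroE (U : opens X) (Ux : U x) : stalk_0 = germ Ux 0.
Proof.
apply/germ_eq; exists U, (fun _ _ => Logic.I), (@subset_refl _ _).
by rewrite !raddf0.
Qed.

Let stalk_addA : associative stalk_add.
Proof.
move=> a b c; have [U [Ux [s [t [u [-> -> ->]]]]]] := germP3 a b c.
by rewrite !addE addrA.
Qed.

Let stalk_addC : commutative stalk_add.
Proof.
move=> a b; have [U [Ux [s [t [-> ->]]]]] := germP2 a b.
by rewrite !addE addrC.
Qed.

Let stalk_add0 : left_id stalk_0 stalk_add.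
Proof.
by move=> a; have [U [Ux [s ->]]] := germP a; rewrite (zeroE Ux) addE add0r.
Qed.

Let stalk_addN : left_inverse stalk_0 stalk_opp stalk_add.
Proof.
move=> a; have [U [Ux [s ->]]] := germP a.
by rewrite (zeroE Ux) oppE addE addNr.
Qed.

HB.instance Definition _ := GRing.isZmodule.Build (stalk P x)
  stalk_addA stalk_addC stalk_add0 stalk_addN.

Lemma germ0 (U : opens X) (Ux : U x) : germ Ux (0 : P U) = 0.
Proof. by rewrite -zeroE. Qed.

Lemma germD (U : opens X) (Ux : U x) (s t : P U) :
  germ Ux (s + t) = germ Ux s + germ Ux t.
Proof. by rewrite -addE. Qed.

Lemma germN (U : opens X) (Ux : U x) (s : P U) : germ Ux (- s) = - germ Ux s.
Proof. by rewrite -oppE. Qed.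

Lemma germB (U : opens X) (Ux : U x) (s t : P U) :
  germ Ux (s - t) = germ Ux s - germ Ux t.
Proof. by rewrite germD germN. Qed.

End StalkZmod.
End Stalk.

(* [E x] is the set of values at x, and a section over U is a function
   x in U |-> s x in E x which near every point of U satisfies [lpred]. *)
Record local_pred (X : topologicalType) (E : X -> zmodType) := LocalPred {
  lpred : forall V : opens X, (forall x, V x -> E x) -> Prop;
  lpred_res : forall (V W : opens X) (WV : W `<=` V) s,
    lpred s -> lpred (fun x (Wx : W x) => s x (WV x Wx));
  lpred0 : forall V : opens X, lpred (fun x (_ : V x) => 0);
  lpredB : forall (V : opens X) (s t : forall x, V x -> E x),
    lpred s -> lpred t -> lpred (fun x Vx => s x Vx - t x Vx)
}.
Arguments lpred {X E} l {V} s.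

Section LocalSections.
Context {X : topologicalType} {E : X -> zmodType} (B : local_pred E).
Implicit Types U V W : opens X.

Definition locally U (s : forall x, U x -> E x) : Prop :=
  forall x, U x -> exists (V : opens X) (VU : V `<=` U),
    V x /\ lpred B (fun y (Vy : V y) => s y (VU y Vy)).

Record lsec U := LSec {
  lval :> forall x, U x -> E x;
  lvalP : locally lval
}.

HB.instance Definition _ U := gen_eqMixin (lsec U).
HB.instance Definition _ U := gen_choiceMixin (lsec U).

Lemma lsec_eq U (s t : lsec U) : (forall x Ux, s x Ux = t x Ux) -> s = t.
Proof.
case: s t => [s sP] [t tP] /= st.
have {}st : s = t by apply/functional_extensionality_dep => x;
  apply/functional_extensionality_dep => Ux; exact: st.
by rewrite st in sP *; congr LSec; exact: Prop_irrelevance.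
Qed.

Lemma lval_irr U (s : lsec U) x (Ux Ux' : U x) : s x Ux = s x Ux'.
Proof. by congr (s _ _); exact: Prop_irrelevance. Qed.

Lemma locally0 U : locally (fun x (_ : U x) => 0).
Proof. by move=> x Ux; exists U, (@subset_refl _ _); split=> //; exact: lpred0. Qed.

Lemma locallyB U (s t : forall x, U x -> E x) :
  locally s -> locally t -> locally (fun x Ux => s x Ux - t x Ux).
Proof.
move=> sP tP x Ux.
have [V [VU [Vx sV]]] := sP x Ux; have [W [WU [Wx tW]]] := tP x Ux.
have VWU : opensI V W `<=` U := subset_trans (@opensIl _ _ _) VU.
exists (opensI V W), VWU; split=> //.
have {}sV := lpred_res (@opensIl _ V W) sV.
have {}tW := lpred_res (@opensIr _ V W) tW.
have := lpredB sV tW; congr (lpred B _).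
apply/functional_extensionality_dep => y.
apply/functional_extensionality_dep => Wy.
by congr (s _ _ - t _ _); exact: Prop_irrelevance.
Qed.

Definition lsec_0 U : lsec U := LSec (@locally0 U).
Definition lsec_sub U (s t : lsec U) : lsec U := LSec (locallyB (lvalP s) (lvalP t)).
Definition lsec_opp U (s : lsec U) : lsec U := lsec_sub (lsec_0 U) s.
Definition lsec_add U (s t : lsec U) : lsec U := lsec_sub s (lsec_opp t).

Let lsec_addE U (s t : lsec U) x (Ux : U x) :
  lsec_add s t x Ux = s x Ux + t x Ux.
Proof. by rewrite /= sub0r opprK. Qed.

Let lsec_addA U : associative (@lsec_add U).
Proof. by move=> s t u; apply: lsec_eq => x Ux; rewrite !lsec_addE addrA. Qed.

Let lsec_addC U : commutative (@lsec_add U).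
Proof. by move=> s t; apply: lsec_eq => x Ux; rewrite !lsec_addE addrC. Qed.

Let lsec_add0 U : left_id (lsec_0 U) (@lsec_add U).
Proof. by move=> s; apply: lsec_eq => x Ux; rewrite lsec_addE add0r. Qed.

Let lsec_addN U : left_inverse (lsec_0 U) (@lsec_opp U) (@lsec_add U).
Proof. by move=> s; apply: lsec_eq => x Ux; rewrite lsec_addE /= sub0r addNr. Qed.

HB.instance Definition _ U := GRing.isZmodule.Build (lsec U)
  (@lsec_addA U) (@lsec_addC U) (@lsec_add0 U) (@lsec_addN U).

Lemma lval0 U x (Ux : U x) : (0 : lsec U) x Ux = 0. Proof. by []. Qed.

Lemma lvalD U (s t : lsec U) x (Ux : U x) : (s + t) x Ux = s x Ux + t x Ux.
Proof. exact: lsec_addE. Qed.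

Lemma lvalN U (s : lsec U) x (Ux : U x) : (- s) x Ux = - s x Ux.
Proof. exact: sub0r. Qed.

Lemma lvalB U (s t : lsec U) x (Ux : U x) : (s - t) x Ux = s x Ux - t x Ux.
Proof. by rewrite lvalD lvalN. Qed.

Lemma locally_res U V (VU : V `<=` U) (s : lsec U) :
  locally (fun x (Vx : V x) => s x (VU x Vx)).
Proof.
move=> x Vx; have [W [WU [Wx sW]]] := lvalP s (VU x Vx).
exists (opensI W V), (@opensIr _ _ _); split=> //.
have := lpred_res (@opensIl _ W V) sW; congr (lpred B _).
apply/functional_extensionality_dep => y.
apply/functional_extensionality_dep => Wy.
by congr (s _ _); exact: Prop_irrelevance.
Qed.

Definition lres U V (VU : V `<=` U) (s : lsec U) : lsec V :=
  LSec (locally_res VU s).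

Let lres_additive U V (VU : V `<=` U) : zmod_morphism (lres VU).
Proof.
by move=> s t; apply: lsec_eq => x Vx; rewrite lvalB; exact: lvalB.
Qed.

HB.instance Definition _ U V (VU : V `<=` U) :=
  GRing.isZmodMorphism.Build (lsec U) (lsec V) (lres VU) (lres_additive VU).

Lemma lres_id U (h : U `<=` U) s : lres h s = s.
Proof. by apply: lsec_eq => x Ux /=; exact: lval_irr. Qed.

Lemma lres_comp U V W (VU : V `<=` U) (WV : W `<=` V) (WU : W `<=` U) s :
  lres WV (lres VU s) = lres WU s.
Proof. by apply: lsec_eq => x Ux /=; exact: lval_irr. Qed.

Definition lsec_presheaf : presheaf X :=
  @Presheaf X lsec (fun U V VU => lres VU) lres_id lres_comp.

Lemma lsec_sheaf : is_sheaf lsec_presheaf.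
Proof.
move=> V I U UV cov s sE.
have sEx i j x (Ux : U i x) (Ux' : U j x) : (s i : lsec _) x Ux = (s j : lsec _) x Ux'.
  have e := congr1 (fun t : lsec (opensI (U i) (U j)) => t x (conj Ux Ux')) (sE i j).
  move: e => /= e.
  by rewrite (lval_irr _ Ux (opensIl (conj Ux Ux'))) e; exact: lval_irr.
have idx x (Vx : V x) : {i | U i x}.
  by apply: cid; have [i _ Ux] := cov x Vx; exists i.
pose t x (Vx : V x) : E x := (s (projT1 (idx x Vx)) : lsec _) x (projT2 (idx x Vx)).
have tE i x (Vx : V x) (Ux : U i x) : t x Vx = (s i : lsec _) x Ux by exact: sEx.
have tP : locally t.
  move=> x Vx; have [i _ Ux] := cov x Vx.
  have [W [WU [Wx sW]]] := lvalP (s i : lsec _) Ux.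
  exists W, (subset_trans WU (UV i)); split=> //.
  move: sW; congr (lpred B _).
  apply/functional_extensionality_dep => y.
  apply/functional_extensionality_dep => Wy.
  by rewrite (tE i y _ (WU y Wy)).
exists (LSec tP : lsec V); split.
  by move=> i; apply: lsec_eq => x Ux; exact: tE.
move=> t' t'E; apply: lsec_eq => x Vx /=; have [i _ Ux] := cov x Vx.
by rewrite (tE i x Vx Ux) -(t'E i); exact: (@lval_irr V t' x).
Qed.

End LocalSections.

Record ring_presheaf (X : topologicalType) := RingPresheaf {
  rsec :> opens X -> comPzRingType;
  rres : forall U V : opens X, V `<=` U -> {rmorphism rsec U -> rsec V};
  rres_id : forall (U : opens X) (h : U `<=` U) s, rres h s = s;
  rres_comp : forall (U V W : opens X)
    (hVU : V `<=` U) (hWV : W `<=` V) (hWU : W `<=` U) s,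
    rres hWV (rres hVU s) = rres hWU s
}.
Arguments rres {X r U V} h.

Definition ring_ab (X : topologicalType) (O : ring_presheaf X) : presheaf X :=
  @Presheaf X (fun U => O U) (fun U V h => rres h) (@rres_id X O)
    (@rres_comp X O).

Record ring_sheaf (X : topologicalType) := RingSheaf {
  ring_sheaf_pre :> ring_presheaf X;
  ring_sheafP : is_sheaf (ring_ab ring_sheaf_pre)
}.

Record mod_presheaf (X : topologicalType) (O : ring_presheaf X) := ModPresheaf {
  msec :> forall U : opens X, lmodType (O U);
  mres : forall U V : opens X, V `<=` U -> {additive msec U -> msec V};
  mresZ : forall (U V : opens X) (h : V `<=` U) (a : O U) (m : msec U),
    mres h (a *: m) = rres h a *: mres h m;
  mres_id : forall (U : opens X) (h : U `<=` U) m, mres h m = m;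
  mres_comp : forall (U V W : opens X)
    (hVU : V `<=` U) (hWV : W `<=` V) (hWU : W `<=` U) m,
    mres hWV (mres hVU m) = mres hWU m
}.
Arguments mres {X O M U V} h : rename.

Definition mod_ab (X : topologicalType) (O : ring_presheaf X)
    (M : mod_presheaf O) : presheaf X :=
  @Presheaf X (fun U => M U) (fun U V h => mres h) (@mres_id X O M)
    (@mres_comp X O M).

Record mod_sheaf (X : topologicalType) (O : ring_presheaf X) := ModSheaf {
  mod_sheaf_pre :> mod_presheaf O;
  mod_sheafP : is_sheaf (mod_ab mod_sheaf_pre)
}.

Record mod_hom (X : topologicalType) (O : ring_presheaf X)
    (M N : mod_presheaf O) := ModHom {
  hmap :> forall U : opens X, {linear M U -> N U};
  hmap_nat : forall (U V : opens X) (h : V `<=` U) (m : M U),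
    mres h (hmap U m) = hmap V (mres h m)
}.

Section RingStalk.
Context {X : topologicalType} (O : ring_presheaf X) (x : X).

Definition rstalk : Type := stalk (ring_ab O) x.

HB.instance Definition _ := GRing.Zmodule.on rstalk.

Definition rgerm (U : opens X) (Ux : U x) (a : O U) : rstalk :=
  germ (P := ring_ab O) Ux a.

Definition rstalk_1 : rstalk := @rgerm (@Opens X setT openT) Logic.I 1.

Definition rstalk_mul (a b : rstalk) : rstalk :=
  @stalk_op2 _ (ring_ab O) (ring_ab O) (ring_ab O)
    (fun U (a b : O U) => a * b) x a b.

Let mulE (U : opens X) (Ux : U x) (a b : O U) :
  rstalk_mul (rgerm Ux a) (rgerm Ux b) = rgerm Ux (a * b).
Proof.
rewrite /rstalk_mul /rgerm.
apply: (@stalk_op2E _ (ring_ab O) (ring_ab O) (ring_ab O) (fun U (a b : O U) => a * b)).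
by move=> U' V h s t /=; rewrite rmorphM.
Qed.

Let oneE (U : opens X) (Ux : U x) : rstalk_1 = rgerm Ux 1.
Proof.
apply/germ_eq; exists U, (fun _ _ => Logic.I), (@subset_refl _ _).
by rewrite /= !rmorph1.
Qed.

Let addE (U : opens X) (Ux : U x) (a b : O U) :
  rgerm Ux a + rgerm Ux b = rgerm Ux (a + b).
Proof. by rewrite /rgerm -(germD (P := ring_ab O)). Qed.

Let rstalk_mulA : associative rstalk_mul.
Proof.
move=> a b c; have [U [Ux [s [t [u [-> -> ->]]]]]] := germP3 a b c.
by rewrite -!/(rgerm Ux _) !mulE mulrA.
Qed.

Let rstalk_mulC : commutative rstalk_mul.
Proof.
move=> a b; have [U [Ux [s [t [-> ->]]]]] := germP2 a b.
by rewrite -!/(rgerm Ux _) !mulE mulrC.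
Qed.

Let rstalk_mul1 : left_id rstalk_1 rstalk_mul.
Proof.
move=> a; have [U [Ux [s ->]]] := germP a.
by rewrite -!/(rgerm Ux _) (oneE Ux) mulE mul1r.
Qed.

Let rstalk_mulD : left_distributive rstalk_mul +%R.
Proof.
move=> a b c; have [U [Ux [s [t [u [-> -> ->]]]]]] := germP3 a b c.
by rewrite -!/(rgerm Ux _) addE !mulE addE mulrDl.
Qed.

HB.instance Definition _ := GRing.Zmodule_isComPzRing.Build rstalk
  rstalk_mulA rstalk_mulC rstalk_mul1 rstalk_mulD.

Let rgerm_additive (U : opens X) (Ux : U x) : zmod_morphism (rgerm Ux).
Proof. by move=> a b; rewrite /rgerm -(germB (P := ring_ab O)). Qed.

Let rgerm_monoid (U : opens X) (Ux : U x) : monoid_morphism (rgerm Ux).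
Proof. by split=> [|a b]; [rewrite -oneE|rewrite -mulE]. Qed.

HB.instance Definition _ (U : opens X) (Ux : U x) :=
  GRing.isZmodMorphism.Build (O U) rstalk (rgerm Ux) (rgerm_additive Ux).
HB.instance Definition _ (U : opens X) (Ux : U x) :=
  GRing.isMonoidMorphism.Build (O U) rstalk (rgerm Ux) (rgerm_monoid Ux).

Lemma rgerm_res (U V : opens X) (VU : V `<=` U) (Ux : U x) (Vx : V x) (a : O U) :
  rgerm Vx (rres VU a) = rgerm Ux a.
Proof. exact: (@germ_res _ (ring_ab O)). Qed.

Lemma rgermP (a : rstalk) :
  exists (U : opens X) (Ux : U x) (s : O U), a = rgerm Ux s.
Proof. exact: (@germP _ (ring_ab O)). Qed.

End RingStalk.

Section ModStalk.
Context {X : topologicalType} {O : ring_presheaf X} (M : mod_presheaf O) (x : X).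

Definition mstalk : Type := stalk (mod_ab M) x.

HB.instance Definition _ := GRing.Zmodule.on mstalk.

Definition mgerm (U : opens X) (Ux : U x) (m : M U) : mstalk :=
  germ (P := mod_ab M) Ux m.

Definition mstalk_scale (a : rstalk O x) (m : mstalk) : mstalk :=
  @stalk_op2 _ (ring_ab O) (mod_ab M) (mod_ab M)
    (fun U (a : O U) (m : M U) => a *: m) x a m.

Let scaleE (U : opens X) (Ux : U x) (a : O U) (m : M U) :
  mstalk_scale (rgerm Ux a) (mgerm Ux m) = mgerm Ux (a *: m).
Proof.
rewrite /mstalk_scale /mgerm.
apply: (@stalk_op2E _ (ring_ab O) (mod_ab M) (mod_ab M) (fun U (a : O U) (m : M U) => a *: m)).
by move=> U' V h s t /=; rewrite mresZ.
Qed.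

Let addE (U : opens X) (Ux : U x) (m n : M U) :
  mgerm Ux m + mgerm Ux n = mgerm Ux (m + n).
Proof. by rewrite /mgerm -(germD (P := mod_ab M)). Qed.

Let raddE (U : opens X) (Ux : U x) (a b : O U) :
  rgerm Ux a + rgerm Ux b = rgerm Ux (a + b).
Proof. by rewrite raddfD. Qed.

Let mstalk_scaleA a b m :
  mstalk_scale a (mstalk_scale b m) = mstalk_scale (a * b) m.
Proof.
have [U [Ux [s [t [u [-> -> ->]]]]]] :=
  germP3 (P := ring_ab O) (Q := ring_ab O) (S := mod_ab M) a b m.
by rewrite -!/(rgerm Ux _) -!/(mgerm Ux _) -rmorphM !scaleE scalerA.
Qed.

Let mstalk_scale1 : left_id 1 mstalk_scale.
Proof.
move=> m; have [U [Ux [s ->]]] := germP (P := mod_ab M) m.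
by rewrite -!/(mgerm Ux _) -(rmorph1 (rgerm Ux)) scaleE scale1r.
Qed.

Let mstalk_scaleDr : right_distributive mstalk_scale +%R.
Proof.
move=> a m n; have [U [Ux [s [t [u [-> -> ->]]]]]] :=
  germP3 (P := ring_ab O) (Q := mod_ab M) (S := mod_ab M) a m n.
by rewrite -!/(rgerm Ux _) -!/(mgerm Ux _) addE !scaleE addE scalerDr.
Qed.

Let mstalk_scaleDl m : {morph mstalk_scale^~ m : a b / a + b}.
Proof.
move=> a b; have [U [Ux [s [t [u [-> -> ->]]]]]] :=
  germP3 (P := ring_ab O) (Q := ring_ab O) (S := mod_ab M) a b m.
by rewrite -!/(rgerm Ux _) -!/(mgerm Ux _) raddE !scaleE addE scalerDl.
Qed.

HB.instance Definition _ := GRing.Zmodule_isLmodule.Build (rstalk O x) mstalk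
  mstalk_scaleA mstalk_scale1 mstalk_scaleDr mstalk_scaleDl.

Let mgerm_additive (U : opens X) (Ux : U x) : zmod_morphism (mgerm Ux).
Proof. by move=> m n; rewrite /mgerm -(germB (P := mod_ab M)). Qed.

HB.instance Definition _ (U : opens X) (Ux : U x) :=
  GRing.isZmodMorphism.Build (M U) mstalk (mgerm Ux) (mgerm_additive Ux).

Lemma mgermZ (U : opens X) (Ux : U x) (a : O U) (m : M U) :
  mgerm Ux (a *: m) = rgerm Ux a *: mgerm Ux m.
Proof. by rewrite -scaleE. Qed.

Lemma mgerm_res (U V : opens X) (VU : V `<=` U) (Ux : U x) (Vx : V x) (m : M U) :
  mgerm Vx (mres VU m) = mgerm Ux m.
Proof. exact: (@germ_res _ (mod_ab M)). Qed.

Lemma mgermP (m : mstalk) :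
  exists (U : opens X) (Ux : U x) (s : M U), m = mgerm Ux s.
Proof. exact: (@germP _ (mod_ab M)). Qed.

Lemma mgerm_eq (U V : opens X) (Ux : U x) (Vx : V x) (s : M U) (t : M V) :
  mgerm Ux s = mgerm Vx t <->
  exists (W : opens X) (WU : W `<=` U) (WV : W `<=` V),
    W x /\ mres WU s = mres WV t.
Proof. exact: (@germ_eq _ (mod_ab M)). Qed.

End ModStalk.

Section StalkMap.
Context {X : topologicalType} {O : ring_presheaf X} {M N : mod_presheaf O}.
Context (f : mod_hom M N) (x : X).

Definition stalk_map (m : mstalk M x) : mstalk N x :=
  @stalk_op1 _ (mod_ab M) (mod_ab N) (fun U => f U) x m.

Lemma stalk_mapE (U : opens X) (Ux : U x) (m : M U) :
  stalk_map (mgerm Ux m) = mgerm Ux (f U m).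
Proof.
rewrite /stalk_map /mgerm.
apply: (@stalk_op1E _ (mod_ab M) (mod_ab N) (fun U => f U)).
by move=> U' V h s /=; rewrite hmap_nat.
Qed.

Let stalk_map_additive : zmod_morphism stalk_map.
Proof.
move=> m n; have [U [Ux [s [t [-> ->]]]]] :=
  germP2 (P := mod_ab M) (Q := mod_ab M) m n.
by rewrite -!/(mgerm Ux _) -raddfB !stalk_mapE !raddfB.
Qed.

Let stalk_map_scalable : scalable stalk_map.
Proof.
move=> a m; have [U [Ux [s [t [-> ->]]]]] :=
  germP2 (P := ring_ab O) (Q := mod_ab M) a m.
by rewrite -!/(rgerm Ux _) -!/(mgerm Ux _) -mgermZ !stalk_mapE linearZ mgermZ.
Qed.

HB.instance Definition _ :=
  GRing.isZmodMorphism.Build _ _ stalk_map stalk_map_additive.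
HB.instance Definition _ :=
  GRing.isScalable.Build _ _ _ _ stalk_map stalk_map_scalable.

End StalkMap.
Arguments stalk_map {X O M N} f x m.

Section Sheafification.
Context {X : topologicalType} {O : ring_presheaf X}.

Section Object.
Context (M : mod_presheaf O).

Let is_germs (V : opens X) (s : forall x, V x -> mstalk M x) : Prop :=
  exists m : M V, forall x Vx, s x Vx = mgerm Vx m.

Let is_germs_res (V W : opens X) (WV : W `<=` V) s :
  @is_germs V s -> @is_germs W (fun x Wx => s x (WV x Wx)).
Proof.
by move=> [m sE]; exists (mres WV m) => x Wx; rewrite sE (mgerm_res WV (WV x Wx)).
Qed.

Let is_germs0 (V : opens X) : @is_germs V (fun x _ => 0).
Proof. by exists 0 => x Vx; rewrite raddf0. Qed.

Let is_germsB (V : opens X) s t : @is_germs V s -> @is_germs V t ->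
  @is_germs V (fun x Vx => s x Vx - t x Vx).
Proof.
by move=> [m sE] [n tE]; exists (m - n) => x Vx; rewrite sE tE raddfB.
Qed.

Definition germ_pred : local_pred (fun x => mstalk M x) :=
  @LocalPred X (fun x => mstalk M x) is_germs is_germs_res is_germs0 is_germsB.

(* The sections over U of the sheafification: families of germs at the points
   of U which are locally the germs of a section of M. *)
Definition shf_sec (U : opens X) : Type := lsec germ_pred U.

HB.instance Definition _ U := GRing.Zmodule.on (shf_sec U).

Lemma shfD U (s t : shf_sec U) x (Ux : U x) :
  lval (s + t) Ux = lval s Ux + lval t Ux.
Proof. exact: lvalD. Qed.

Lemma shfB U (s t : shf_sec U) x (Ux : U x) :
  lval (s - t) Ux = lval s Ux - lval t Ux.
Proof. exact: lvalB. Qed.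

Let shf_scale_subproof (U : opens X) (a : O U) (s : shf_sec U) :
  locally germ_pred (fun x Ux => rgerm Ux a *: lval s Ux).
Proof.
move=> x Ux; have [V [VU [Vx [m mE]]]] := lvalP s Ux.
exists V, VU; split=> //; exists (rres VU a *: m) => y Vy.
by rewrite mE mgermZ (rgerm_res VU (VU y Vy)).
Qed.

Definition shf_scale (U : opens X) (a : O U) (s : shf_sec U) : shf_sec U :=
  LSec (@shf_scale_subproof U a s).

Let shf_scaleA U (a b : O U) s :
  shf_scale a (shf_scale b s) = shf_scale (a * b) s.
Proof. by apply: lsec_eq => x Ux /=; rewrite scalerA rmorphM. Qed.

Let shf_scale1 U : left_id 1 (@shf_scale U).
Proof. by move=> s; apply: lsec_eq => x Ux /=; rewrite rmorph1 scale1r. Qed.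

Let shf_scaleDr U : right_distributive (@shf_scale U) +%R.
Proof.
move=> a s t; apply: lsec_eq => x Ux.
rewrite [RHS](shfD (shf_scale a s)).
exact: etrans (congr1 _ (shfD s t Ux)) (scalerDr _ _ _).
Qed.

Let shf_scaleDl U s : {morph (@shf_scale U)^~ s : a b / a + b}.
Proof.
move=> a b; apply: lsec_eq => x Ux.
by rewrite [RHS](shfD (shf_scale a s)) /= raddfD scalerDl.
Qed.

HB.instance Definition _ U := GRing.Zmodule_isLmodule.Build (O U) (shf_sec U)
  (@shf_scaleA U) (@shf_scale1 U) (@shf_scaleDr U) (@shf_scaleDl U).

Let shf_resZ (U V : opens X) (h : V `<=` U) (a : O U) (s : shf_sec U) :
  lres h (a *: s) = rres h a *: (lres h s : shf_sec V).
Proof. by apply: lsec_eq => x Vx /=; rewrite (rgerm_res h (h x Vx)). Qed.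

Definition sheafify_pre : mod_presheaf O :=
  @ModPresheaf X O shf_sec (fun U V h => lres h) shf_resZ
    (@lres_id _ _ germ_pred) (@lres_comp _ _ germ_pred).

Definition sheafify : mod_sheaf O :=
  @ModSheaf X O sheafify_pre (@lsec_sheaf _ _ germ_pred).

End Object.

Section Morphism.
Context {M N : mod_presheaf O} (f : mod_hom M N).

Let shf_map_subproof (U : opens X) (s : shf_sec M U) :
  locally (germ_pred N) (fun x Ux => stalk_map f x (lval s Ux)).
Proof.
move=> x Ux; have [V [VU [Vx [m mE]]]] := lvalP s Ux.
by exists V, VU; split=> //; exists (f V m) => y Vy; rewrite mE stalk_mapE.
Qed.

Definition shf_map (U : opens X) (s : shf_sec M U) : shf_sec N U :=
  LSec (@shf_map_subproof U s).

Let shf_map_additive U : zmod_morphism (@shf_map U).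
Proof.
move=> s t; apply: lsec_eq => x Ux.
rewrite [RHS](shfB (shf_map s)).
exact: etrans (congr1 _ (shfB s t Ux)) (raddfB _ _ _).
Qed.

Let shf_map_scalable U : scalable (@shf_map U).
Proof. by move=> a s; apply: lsec_eq => x Ux /=; rewrite linearZ. Qed.

HB.instance Definition _ U :=
  GRing.isZmodMorphism.Build _ _ (@shf_map U) (@shf_map_additive U).
HB.instance Definition _ U :=
  GRing.isScalable.Build _ _ _ _ (@shf_map U) (@shf_map_scalable U).

Let shf_map_nat (U V : opens X) (h : V `<=` U) (s : sheafify M U) :
  mres (M := sheafify N) h (shf_map s) = shf_map (mres h s).
Proof. exact: lsec_eq. Qed.

Definition sheafify_map : mod_hom (sheafify M) (sheafify N) :=
  @ModHom X O (sheafify M) (sheafify N) (fun U => @shf_map U) shf_map_nat.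

End Morphism.
End Sheafification.

Section TensorSheaf.
Context {X : topologicalType} {O : ring_presheaf X}.
Implicit Types M N F G : mod_presheaf O.

Section Object.
Context (M N : mod_presheaf O).

Definition tensor_res (U V : opens X) (h : V `<=` U) :
    tensor (M U) (N U) -> tensor (M V) (N V) :=
  tensor_map (mres h) (mres h).

Let tensor_res_additive (U V : opens X) (h : V `<=` U) :
  zmod_morphism (tensor_res h).
Proof. exact: tensor_map_additive (mresZ h) (mresZ h). Qed.

HB.instance Definition _ (U V : opens X) (h : V `<=` U) :=
  GRing.isZmodMorphism.Build _ _ (tensor_res h) (tensor_res_additive h).

Lemma tensor_resD (U V : opens X) (h : V `<=` U) t u :
  tensor_res h (t + u) = tensor_res h t + tensor_res h u.
Proof. exact: raddfD. Qed.

Lemma tensor_res0 (U V : opens X) (h : V `<=` U) : tensor_res h 0 = 0.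
Proof. exact: raddf0. Qed.

Lemma tensor_resZ (U V : opens X) (h : V `<=` U) (a : O U) t :
  tensor_res h (a *: t) = rres h a *: tensor_res h t.
Proof. exact: tensor_mapZ (mresZ h) (mresZ h) _ _. Qed.

Lemma tensor_res_prod (U V : opens X) (h : V `<=` U) m n :
  tensor_res h (tprod m n) = tprod (mres h m) (mres h n).
Proof. exact: tensor_map_prod (mresZ h) (mresZ h) _ _. Qed.

Let tensor_res_id (U : opens X) (h : U `<=` U) t : tensor_res h t = t.
Proof.
move: t; apply: tensor_ind => [|m n t IH]; first exact: tensor_res0.
by rewrite tensor_resD IH tensor_res_prod !mres_id.
Qed.

Let tensor_res_comp (U V W : opens X)
    (hVU : V `<=` U) (hWV : W `<=` V) (hWU : W `<=` U) t :
  tensor_res hWV (tensor_res hVU t) = tensor_res hWU t.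
Proof.
move: t; apply: tensor_ind => [|m n t IH]; first by rewrite !tensor_res0.
by rewrite !tensor_resD IH !tensor_res_prod !(mres_comp _ _ hWU).
Qed.

Definition tensor_presheaf : mod_presheaf O :=
  @ModPresheaf X O (fun U => tensor (M U) (N U)) (fun U V h => tensor_res h)
    tensor_resZ tensor_res_id tensor_res_comp.

Definition tensor_sheaf : mod_sheaf O := sheafify tensor_presheaf.

End Object.

Section Morphism.
Context (M : mod_presheaf O) {F G : mod_presheaf O} (tau : mod_hom F G).

Definition id_tensor_sec (U : opens X) :
    tensor (M U) (F U) -> tensor (M U) (G U) :=
  tensor_map idfun (tau U).

Let id_tensor_additive (U : opens X) : zmod_morphism (@id_tensor_sec U).
Proof.
apply: (@tensor_map_additive _ _ id _ _ _ _ idfun (tau U)) => // a m.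
exact: linearZ.
Qed.

Let id_tensor_scalable (U : opens X) : scalable (@id_tensor_sec U).
Proof.
move=> a t; apply: (@tensor_mapZ _ _ id _ _ _ _ idfun (tau U)) => // b m.
exact: linearZ.
Qed.

HB.instance Definition _ (U : opens X) :=
  GRing.isZmodMorphism.Build _ _ (@id_tensor_sec U) (@id_tensor_additive U).
HB.instance Definition _ (U : opens X) :=
  GRing.isScalable.Build _ _ _ _ (@id_tensor_sec U) (@id_tensor_scalable U).

Lemma id_tensor_prod (U : opens X) m n :
  @id_tensor_sec U (tprod m n) = tprod m (tau U n).
Proof.
apply: (@tensor_map_prod _ _ id _ _ _ _ idfun (tau U)) => // a k.
exact: linearZ.
Qed.

Let id_tensor0 (U : opens X) : @id_tensor_sec U 0 = 0.
Proof. exact: raddf0. Qed.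

Let id_tensorD (U : opens X) t u :
  @id_tensor_sec U (t + u) = id_tensor_sec t + id_tensor_sec u.
Proof. exact: raddfD. Qed.

Let id_tensor_nat (U V : opens X) (h : V `<=` U) (t : tensor (M U) (F U)) :
  tensor_res h (id_tensor_sec t) = id_tensor_sec (tensor_res h t).
Proof.
move: t; apply: tensor_ind => [|m n t IH].
  by rewrite id_tensor0 !tensor_res0 id_tensor0.
rewrite id_tensorD !tensor_resD id_tensorD IH.
by rewrite id_tensor_prod !tensor_res_prod id_tensor_prod hmap_nat.
Qed.

Definition id_tensor_pre : mod_hom (tensor_presheaf M F) (tensor_presheaf M G) :=
  @ModHom X O (tensor_presheaf M F) (tensor_presheaf M G)
    (fun U => @id_tensor_sec U) id_tensor_nat.

Definition id_tensor : mod_hom (tensor_sheaf M F) (tensor_sheaf M G) :=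
  sheafify_map id_tensor_pre.

End Morphism.
End TensorSheaf.

(* Exactness of 0 -> F -> G: the kernel sheaf, computed on sections, is 0. *)
Definition mono_exact (X : topologicalType) (O : ring_presheaf X)
    (F G : mod_sheaf O) (tau : mod_hom F G) : Prop :=
  forall (U : opens X) (s : F U), tau U s = 0 -> s = 0.

Definition pure_exact (X : topologicalType) (O : ring_presheaf X)
    (F G : mod_sheaf O) (tau : mod_hom F G) : Prop :=
  mono_exact tau /\
  forall M : mod_sheaf O, mono_exact (id_tensor M tau).

Section Ideals.
Context {A : comPzRingType}.
Implicit Types I J : set A.

Definition is_ideal I : Prop :=
  [/\ I 0, (forall a b, I a -> I b -> I (a + b)) & forall a b, I b -> I (a * b)].

Definition is_prime I : Prop :=
  [/\ is_ideal I, ~ I 1 & forall a b, I (a * b) -> I a \/ I b].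

Definition is_maximal I : Prop :=
  [/\ is_ideal I, ~ I 1 &
      forall J, is_ideal J -> ~ J 1 -> I `<=` J -> J = I].

End Ideals.

Definition local_ring (A : comPzRingType) : Prop :=
  exists! I : set A, is_maximal I.

Record spec (A : comPzRingType) := Spec {
  sideal :> A -> Prop;
  sprime : is_prime sideal
}.

Section SpecTopology.
Context (A : comPzRingType).

HB.instance Definition _ := gen_eqMixin (spec A).
HB.instance Definition _ := gen_choiceMixin (spec A).

(* Zariski topology: the closed sets are the V(E) = {p | E is contained in p}. *)
Definition zariski_open (U : set (spec A)) : Prop :=
  exists E : set A, U = [set p : spec A | ~ (E `<=` p)].

Let zariski_openT : zariski_open setT.
Proof.
exists setT; apply/seteqP; split=> // p _ /= Ep.
by case: (sprime p) => _ p1 _; apply: p1; exact: Ep.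
Qed.

Let zariski_openI : setI_closed zariski_open.
Proof.
move=> _ _ [E ->] [F ->]; exists [set a | exists b c, [/\ E b, F c & a = b * c]].
apply/seteqP; split=> p /=; case: (sprime p) => -[p0 pD pM] p1 pP.
- move=> [/existsNP[b /not_implyP[Eb pb]] /existsNP[c /not_implyP[Fc pc]]] EF.
  have /pP[] // : p (b * c) by apply: EF; exists b, c.
- move=> EF; split=> Ep; apply: EF => _ [b [c [Eb Fc ->]]].
    by rewrite mulrC; apply: pM; exact: Ep.
  by apply: pM; exact: Ep.
Qed.

Let zariski_open_bigU (I : Type) (f : I -> set (spec A)) :
  (forall i, zariski_open (f i)) -> zariski_open (\bigcup_i f i).
Proof.
move=> fop; pose E i := projT1 (cid (fop i)).
have fE i : f i = [set p : spec A | ~ (E i `<=` p)] := projT2 (cid (fop i)).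
exists (\bigcup_i E i); apply/seteqP; split=> p /=.
  by move=> [i _]; rewrite fE /= => Ep sub; apply: Ep => a Ea; apply: sub; exists i.
move=> /existsNP[a /not_implyP[[i _ Ea] pa]]; exists i => //.
by rewrite fE /= => sub; exact/pa/sub.
Qed.

HB.instance Definition _ := isOpenTopological.Build (spec A)
  zariski_openT zariski_openI zariski_open_bigU.

End SpecTopology.

Section Localization.
Context {A : comPzRingType} (p : spec A).

Lemma spec1 : ~ p 1. Proof. by case: (sprime p). Qed.

Lemma specM (a b : A) : ~ p a -> ~ p b -> ~ p (a * b).
Proof. by case: (sprime p) => _ _ pP pa pb /pP[]. Qed.

Record frac := Frac { num : A; den : A; den_notin : ~ p den }.
Arguments den_notin : clear implicits.

HB.instance Definition _ := gen_eqMixin frac.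
HB.instance Definition _ := gen_choiceMixin frac.

Definition frac_rel (f g : frac) : Prop :=
  exists2 u : A, ~ p u & u * (num f * den g) = u * (num g * den f).

Lemma frac_refl f : frac_rel f f.
Proof. by exists 1 => //; exact: spec1. Qed.

Lemma frac_sym f g : frac_rel f g -> frac_rel g f.
Proof. by move=> [u pu e]; exists u. Qed.

Lemma frac_trans f g h : frac_rel f g -> frac_rel g h -> frac_rel f h.
Proof.
move=> [u pu e] [v pv e']; exists (u * v * den g).
  by apply: specM; [exact: specM|exact: den_notin].
have -> : u * v * den g * (num f * den h) =
  v * den h * (u * (num f * den g)) by ring.
rewrite e.
have -> : v * den h * (u * (num g * den f)) =
  u * den f * (v * (num g * den h)) by ring.
by rewrite e'; ring.
Qed.

Definition frac_equiv : equiv_rel frac := prop_equiv frac_refl frac_sym frac_trans.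

Definition loc : Type := {eq_quot frac_equiv}.

HB.instance Definition _ := Choice.copy loc {eq_quot frac_equiv}.

Definition locf (f : frac) : loc := \pi_({eq_quot frac_equiv}) f.
Definition loc_repr (a : loc) : frac := repr (a : {eq_quot frac_equiv}).

Lemma loc_reprK (a : loc) : locf (loc_repr a) = a. Proof. exact: reprK. Qed.

Lemma locf_eq (f g : frac) : locf f = locf g <-> frac_rel f g.
Proof. exact: prop_eqmodP. Qed.

Definition frac_add (f g : frac) : frac :=
  Frac (num f * den g + num g * den f) (specM (den_notin f) (den_notin g)).
Definition frac_opp (f : frac) : frac := Frac (- num f) (den_notin f).
Definition frac_mul (f g : frac) : frac :=
  Frac (num f * num g) (specM (den_notin f) (den_notin g)).
Definition frac_const (a : A) : frac := Frac a spec1.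

Definition loc_add (a b : loc) : loc := locf (frac_add (loc_repr a) (loc_repr b)).
Definition loc_opp (a : loc) : loc := locf (frac_opp (loc_repr a)).
Definition loc_mul (a b : loc) : loc := locf (frac_mul (loc_repr a) (loc_repr b)).

Let addE f g : loc_add (locf f) (locf g) = locf (frac_add f g).
Proof.
have /locf_eq[u pu e] := loc_reprK (locf f).
have /locf_eq[v pv e'] := loc_reprK (locf g).
apply/locf_eq; exists (u * v); first exact: specM.
rewrite /=; set f' := loc_repr _ in e *; set g' := loc_repr _ in e' *.
have -> : u * v * ((num f' * den g' + num g' * den f') * (den f * den g)) =
  v * den g' * den g * (u * (num f' * den f)) +
  u * den f' * den f * (v * (num g' * den g)) by ring.
by rewrite e e'; ring.
Qed.

Let oppE f : loc_opp (locf f) = locf (frac_opp f).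
Proof.
have /locf_eq[u pu e] := loc_reprK (locf f).
apply/locf_eq; exists u => //=.
by rewrite !mulNr !mulrN e.
Qed.

Let mulE f g : loc_mul (locf f) (locf g) = locf (frac_mul f g).
Proof.
have /locf_eq[u pu e] := loc_reprK (locf f).
have /locf_eq[v pv e'] := loc_reprK (locf g).
apply/locf_eq; exists (u * v); first exact: specM.
rewrite /=; set f' := loc_repr _ in e *; set g' := loc_repr _ in e' *.
have -> : u * v * (num f' * num g' * (den f * den g)) =
  (u * (num f' * den f)) * (v * (num g' * den g)) by ring.
by rewrite e e'; ring.
Qed.

Let eq_frac f g : num f * den g = num g * den f -> locf f = locf g.
Proof. by move=> e; apply/locf_eq; exists 1; [exact: spec1|rewrite e]. Qed.

Let loc_addA : associative loc_add.
Proof.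
move=> a b c; rewrite -(loc_reprK a) -(loc_reprK b) -(loc_reprK c) !addE.
by apply: eq_frac => /=; ring.
Qed.

Let loc_addC : commutative loc_add.
Proof.
move=> a b; rewrite -(loc_reprK a) -(loc_reprK b) !addE.
by apply: eq_frac => /=; ring.
Qed.

Let loc_add0 : left_id (locf (frac_const 0)) loc_add.
Proof.
move=> a; rewrite -(loc_reprK a) !addE.
by apply: eq_frac => /=; ring.
Qed.

Let loc_addN : left_inverse (locf (frac_const 0)) loc_opp loc_add.
Proof.
move=> a; rewrite -(loc_reprK a) oppE addE.
by apply: eq_frac => /=; ring.
Qed.

HB.instance Definition _ := GRing.isZmodule.Build loc
  loc_addA loc_addC loc_add0 loc_addN.

Let loc_mulA : associative loc_mul.
Proof.
move=> a b c; rewrite -(loc_reprK a) -(loc_reprK b) -(loc_reprK c) !mulE.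
by apply: eq_frac => /=; ring.
Qed.

Let loc_mulC : commutative loc_mul.
Proof.
move=> a b; rewrite -(loc_reprK a) -(loc_reprK b) !mulE.
by apply: eq_frac => /=; ring.
Qed.

Let loc_mul1 : left_id (locf (frac_const 1)) loc_mul.
Proof.
move=> a; rewrite -(loc_reprK a) !mulE.
by apply: eq_frac => /=; ring.
Qed.

Let loc_mulD : left_distributive loc_mul +%R.
Proof.
move=> a b c; rewrite -(loc_reprK a) -(loc_reprK b) -(loc_reprK c).
have addE' f g : locf f + locf g = locf (frac_add f g) := addE f g.
rewrite addE' !mulE addE'.
by apply: eq_frac => /=; ring.
Qed.

HB.instance Definition _ := GRing.Zmodule_isComPzRing.Build loc
  loc_mulA loc_mulC loc_mul1 loc_mulD.

Definition fraction (a f : A) (pf : ~ p f) : loc := locf (Frac a pf).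

Lemma fraction0 : fraction 0 spec1 = 0. Proof. by []. Qed.
Lemma fraction1 : fraction 1 spec1 = 1. Proof. by []. Qed.

Lemma fraction_irr a f (pf pf' : ~ p f) : fraction a pf = fraction a pf'.
Proof. by rewrite (Prop_irrelevance pf pf'). Qed.

Lemma fractionB a b f g (pf : ~ p f) (pg : ~ p g) :
  fraction a pf - fraction b pg = fraction (a * g - b * f) (specM pf pg).
Proof.
rewrite -[_ - _]/(loc_add _ (loc_opp _)) oppE addE; apply: eq_frac => /=.
by rewrite mulNr.
Qed.

Lemma fractionM a b f g (pf : ~ p f) (pg : ~ p g) :
  fraction a pf * fraction b pg = fraction (a * b) (specM pf pg).
Proof. by rewrite -[_ * _]/(loc_mul _ _) mulE. Qed.

End Localization.

Section SpecSheaf.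
Context (A : comPzRingType).

Let is_fraction (V : opens (spec A)) (s : forall p, V p -> loc p) : Prop :=
  exists a f : A, forall (p : spec A) (Vp : V p), exists pf : ~ p f, s p Vp = fraction a pf.

Let is_fraction_res (V W : opens (spec A)) (WV : W `<=` V) s :
  @is_fraction V s -> @is_fraction W (fun p Wp => s p (WV p Wp)).
Proof. by move=> [a [f sE]]; exists a, f => p Wp; exact: sE. Qed.

Let is_fraction0 (V : opens (spec A)) : @is_fraction V (fun p _ => 0).
Proof. by exists 0, 1 => p Vp; exists (spec1 (p := p)). Qed.

Let is_fractionB (V : opens (spec A)) s t : @is_fraction V s ->
  @is_fraction V t -> @is_fraction V (fun p Vp => s p Vp - t p Vp).
Proof.
move=> [a [f sE]] [b [g tE]]; exists (a * g - b * f), (f * g) => p Vp.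
have [pf ->] := sE p Vp; have [pg ->] := tE p Vp.
by exists (specM pf pg); exact: fractionB.
Qed.

Definition fraction_pred : local_pred (fun p : spec A => loc p) :=
  @LocalPred _ (fun p : spec A => loc p) is_fraction is_fraction_res
    is_fraction0 is_fractionB.

Definition spec_sec (U : opens (spec A)) : Type := lsec fraction_pred U.

HB.instance Definition _ U := GRing.Zmodule.on (spec_sec U).

Let spec_1_subproof (U : opens (spec A)) :
  locally fraction_pred (fun p (_ : U p) => 1 : loc p).
Proof.
move=> p Up; exists U, (@subset_refl _ _); split=> //.
by exists 1, 1 => q Uq; exists (spec1 (p := q)).
Qed.

Let spec_mul_subproof (U : opens (spec A)) (s t : spec_sec U) :
  locally fraction_pred (fun p Up => (lval s Up : loc p) * lval t Up).
Proof.
move=> p Up; have [V [VU [Vp [a [f sE]]]]] := lvalP s Up.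
have [W [WU [Wp [b [g tE]]]]] := lvalP t Up.
exists (opensI V W), (subset_trans (@opensIl _ V W) VU); split=> //.
exists (a * b), (f * g) => q [Vq Wq].
have [qf sq] := sE q Vq; have [qg tq] := tE q Wq; exists (specM qf qg).
by rewrite -fractionM -sq -tq; congr (_ * _); exact: lval_irr.
Qed.

Definition spec_1 U : spec_sec U := LSec (@spec_1_subproof U).
Definition spec_mul U (s t : spec_sec U) : spec_sec U :=
  LSec (@spec_mul_subproof U s t).

Let spec_mulA U : associative (@spec_mul U).
Proof. by move=> s t u; apply: lsec_eq => p Up /=; rewrite mulrA. Qed.

Let spec_mulC U : commutative (@spec_mul U).
Proof. by move=> s t; apply: lsec_eq => p Up /=; rewrite mulrC. Qed.

Let spec_mul1 U : left_id (spec_1 U) (@spec_mul U).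
Proof. by move=> s; apply: lsec_eq => p Up /=; rewrite mul1r. Qed.

Let spec_mulD U : left_distributive (@spec_mul U) +%R.
Proof.
move=> s t u; apply: lsec_eq => p Up.
rewrite [RHS](lvalD (spec_mul s u : lsec _ _)).
exact: etrans (congr1 ( *%R^~ _) (lvalD (s : lsec _ _) t Up)) (mulrDl _ _ _).
Qed.

HB.instance Definition _ U := GRing.Zmodule_isComPzRing.Build (spec_sec U)
  (@spec_mulA U) (@spec_mulC U) (@spec_mul1 U) (@spec_mulD U).

Definition spec_res (U V : opens (spec A)) (h : V `<=` U) :
  spec_sec U -> spec_sec V := lres h.

Let spec_res_additive U V (h : (V : opens (spec A)) `<=` (U : opens (spec A))) :
  zmod_morphism (spec_res h).
Proof. exact: (raddfB (lres h)). Qed.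

Let spec_res_monoid U V (h : (V : opens (spec A)) `<=` (U : opens (spec A))) :
  monoid_morphism (spec_res h).
Proof. by split=> [|s t]; exact: lsec_eq. Qed.

HB.instance Definition _ U V h :=
  GRing.isZmodMorphism.Build _ _ (@spec_res U V h) (spec_res_additive h).
HB.instance Definition _ U V h :=
  GRing.isMonoidMorphism.Build _ _ (@spec_res U V h) (spec_res_monoid h).

Definition spec_ring_presheaf : ring_presheaf (spec A) :=
  @RingPresheaf (spec A) spec_sec (fun U V h => spec_res h)
    (@lres_id _ _ fraction_pred) (@lres_comp _ _ fraction_pred).

Definition spec_sheaf : ring_sheaf (spec A) :=
  @RingSheaf _ spec_ring_presheaf (@lsec_sheaf _ _ fraction_pred).

End SpecSheaf.

Record ringed_space := RingedSpace {
  rs_top :> topologicalType;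
  rs_sheaf : ring_sheaf rs_top
}.

Definition Spec_rs (A : comPzRingType) : ringed_space :=
  RingedSpace (spec_sheaf A).

Lemma opens_preim_sub (X Y : topologicalType) (f : X -> Y)
    (fc : continuous f) (V W : opens Y) :
  W `<=` V -> opens_preim fc W `<=` opens_preim fc V.
Proof. by move=> WV x; exact: WV. Qed.
Arguments opens_preim_sub {X Y f} fc {V W} _.

(* An isomorphism of ringed spaces is automatically local on stalks, so this is
   also the notion of isomorphism of locally ringed spaces. *)
Definition rs_iso (X Y : ringed_space) : Prop :=
  exists (f : X -> Y) (fc : continuous f) (g : Y -> X)
    (phi : forall V : opens Y,
       {rmorphism rs_sheaf Y V -> rs_sheaf X (opens_preim fc V)}),
  [/\ continuous g, cancel f g, cancel g f,
      (forall V, bijective (phi V)) &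
      forall (V W : opens Y) (h : W `<=` V) (s : rs_sheaf Y V),
        rres (opens_preim_sub fc h) (phi V s) = phi W (rres h s)].

Section Restriction.
Context (X : ringed_space) (U : opens X).

Definition open_sub : topologicalType := set_type (U : set X).

Let open_image (V : opens open_sub) : open (set_val @` (V : set open_sub)).
Proof.
have [W oW WV] : open (V : set open_sub) := oset_open V.
have -> : set_val @` (V : set open_sub) = (W : set X) `&` (U : set X).
  apply/seteqP; split=> [_ [y Vy <-]|x [Wx Ux]].
    split; last exact: set_valP.
    by move: Vy; rewrite -WV.
  exists (SigSub (mem_set Ux) : open_sub) => //.
  by rewrite -WV.
exact: openI oW (oset_open U).
Qed.

Definition opens_image (V : opens open_sub) : opens X := Opens (open_image V).

Lemma opens_image_sub (V W : opens open_sub) :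
  W `<=` V -> opens_image W `<=` opens_image V.
Proof. exact: image_subset. Qed.

Let O := rs_sheaf X.

Let restr_id (V : opens open_sub) (h : V `<=` V) (s : O (opens_image V)) :
  rres (opens_image_sub h) s = s.
Proof. exact: rres_id. Qed.

Let restr_comp (V W T : opens open_sub) (hVW : W `<=` V) (hWT : T `<=` W)
    (hVT : T `<=` V) (s : O (opens_image V)) :
  rres (opens_image_sub hWT) (rres (opens_image_sub hVW) s) =
  rres (opens_image_sub hVT) s.
Proof. exact: rres_comp. Qed.

Definition restr_presheaf : ring_presheaf open_sub :=
  @RingPresheaf open_sub (fun V => O (opens_image V))
    (fun V W h => rres (opens_image_sub h)) restr_id restr_comp.

Let restr_sheafP : is_sheaf (ring_ab restr_presheaf).
Proof.
move=> V I W WV cov s sE.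
have cov' : opens_image V `<=` \bigcup_i (opens_image (W i) : set X).
  move=> _ [y Vy <-]; have [i _ Wy] := cov y Vy.
  by exists i => //; exists y.
apply: (@ring_sheafP X O (opens_image V) I (fun i => opens_image (W i))
  (fun i => opens_image_sub (WV i)) cov' s) => i j.
have sub : opensI (opens_image (W i)) (opens_image (W j)) `<=`
    opens_image (opensI (W i) (W j)).
  move=> _ [[y Wy <-] [z Wz zy]]; exists y => //; split=> //.
  by rewrite -(val_inj zy).
have /(congr1 (rres sub)) := sE i j.
by rewrite /= !(rres_comp _ sub (@opensIl _ _ _)) !(rres_comp _ sub (@opensIr _ _ _)).
Qed.

Definition restr_sheaf : ring_sheaf open_sub := RingSheaf restr_sheafP.

Definition rs_restrict : ringed_space := RingedSpace restr_sheaf.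

End Restriction.

Definition is_scheme (X : ringed_space) : Prop :=
  (forall x : X, local_ring (rstalk (rs_sheaf X) x)) /\
  (forall x : X, exists (U : opens X) (A : comPzRingType),
     U x /\ rs_iso (rs_restrict U) (Spec_rs A)).

Record scheme := Scheme {
  scheme_rs :> ringed_space;
  schemeP : is_scheme scheme_rs
}.

(* Main.v *)
Require Import Defs.
From HB Require Import structures.
From mathcomp Require Import all_boot all_algebra.
From mathcomp Require Import boolp classical_sets topology_structure.

(** Both conditions say that [id (x) tau_x] is injective on [T (x) F_x], for all
points [x] and for the modules [T] in a certain class: the stalks [M_x] of
sheaves of modules for condition 1, all [O_x]-modules for condition 2.

For condition 1: a morphism between sheafifications is injective on sections
exactly when the morphism of presheaves is injective on stalks
([mono_sheafifyP]), and the stalk of the presheaf tensor product is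
[M_x (x) F_x], naturally in [F] ([stalk_tensor_inj],
[stalk_tensor_surj], [stalk_tensor_nat]).
This isomorphism exists because an element of [M_x (x) F_x] involves finitely
many germs, which have representatives over one open set, and because tensors
with equal germs at [x] are already equal over a neighbourhood of [x].

The two classes give the same condition because every [O_x]-module [T] is a
retract of the stalk at [x] of a sheaf, the skyscraper sheaf at [x] with value
[T] ([skyscraper_germK]), and injectivity of [id (x) tau_x] passes to retracts
([tensor_inj_retract]). That [tau_x] itself is injective follows from the
exactness of the sequence ([stalk_map_inj]). *)

Set Implicit Arguments.
Unset Strict Implicit.
Unset Printing Implicit Defensive.

Import GRing.Theory.
Local Open Scope classical_set_scope.
Local Open Scope ring_scope.

(** * Maps between and out of tensor products *)

Section TensorMapComp.
Context {R S S' : comPzRingType} {phi : R -> S} {psi : S -> S'}.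
Context {M N : lmodType R} {M' N' : lmodType S} {M'' N'' : lmodType S'}.
Variables (f : {additive M -> M'}) (g : {additive N -> N'}).
Variables (f' : {additive M' -> M''}) (g' : {additive N' -> N''}).
Hypothesis fZ : forall a m, f (a *: m) = phi a *: f m.
Hypothesis gZ : forall a m, g (a *: m) = phi a *: g m.
Hypothesis f'Z : forall a m, f' (a *: m) = psi a *: f' m.
Hypothesis g'Z : forall a m, g' (a *: m) = psi a *: g' m.

Lemma tensor_map_comp t :
  tensor_map f' g' (tensor_map f g t) = tensor_map (f' \o f) (g' \o g) t.
Proof.
rewrite -(treprK t) (tensor_map_sum fZ gZ) (tensor_map_sum f'Z g'Z).
rewrite (@tensor_map_sum _ _ (psi \o phi) _ _ _ _ (f' \o f) (g' \o g)).
- by rewrite /tmap_seq -map_comp.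
- by move=> a m /=; rewrite fZ f'Z.
- by move=> a m /=; rewrite gZ g'Z.
Qed.

End TensorMapComp.

Lemma eq_tensor_map {R S : comPzRingType} {M N : lmodType R} {M' N' : lmodType S}
    (f f' : M -> M') (g g' : N -> N') :
  f =1 f' -> g =1 g' -> tensor_map f g =1 tensor_map f' g'.
Proof. by move=> /funext -> /funext ->. Qed.

Lemma tensor_map_id {R : comPzRingType} {M N : lmodType R} (t : tensor M N) :
  tensor_map idfun idfun t = t.
Proof.
rewrite -[in RHS](treprK t) /tensor_map /tmap_seq; congr tsum.
by rewrite -[RHS]map_id; apply: eq_map => -[].
Qed.

Section TensorLift.
Context {R : comPzRingType} {M N : lmodType R} {P : zmodType}.
Variable b : M -> N -> P.
Hypothesis bDl : forall m m' n, b (m + m') n = b m n + b m' n.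
Hypothesis bDr : forall m n n', b m (n + n') = b m n + b m n'.
Hypothesis bZ : forall a m n, b (a *: m) n = b m (a *: n).

Definition tensor_lift (t : tensor M N) : P := \sum_(p <- trepr t) b p.1 p.2.

Lemma tensor_lift_sum s : tensor_lift (tsum s) = \sum_(p <- s) b p.1 p.2.
Proof.
rewrite /tensor_lift.
move: (trepr _) (trepr_rel s) => s' rel; elim: rel => {s s'} //.
- by move=> s t u _ -> _ ->.
- by move=> s s' t t' _ e _ e'; rewrite !big_cat e e'.
- by move=> s t; rewrite !big_cat /= addrC.
- by move=> m m' n; rewrite !big_cons !big_nil /= !addr0 bDl.
- by move=> m n n'; rewrite !big_cons !big_nil /= !addr0 bDr.
- by move=> a m n; rewrite !big_seq1 /= bZ.
- move=> n; rewrite big_seq1 big_nil /=.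
  by apply: (addIr (b 0 n)); rewrite -bDl !add0r.
Qed.

Lemma tensor_lift0 : tensor_lift 0 = 0.
Proof. by rewrite -tsum_nil tensor_lift_sum big_nil. Qed.

Lemma tensor_lift_prodD m n t :
  tensor_lift (tprod m n + t) = b m n + tensor_lift t.
Proof. by rewrite -(treprK t) -tsum_cons !tensor_lift_sum big_cons. Qed.

End TensorLift.

(** If [j \o i = id], then [T (x) L -> T (x) L'] is a restriction of
[T' (x) L -> T' (x) L'] to the subgroups that [i (x) id] embeds. *)
Lemma tensor_inj_retract {R : comPzRingType} {L L' T T' : lmodType R}
    (f : {linear L -> L'}) (i : {linear T -> T'}) (j : {linear T' -> T}) :
  cancel i j ->
  injective (tensor_map idfun f : tensor T' L -> tensor T' L') ->
  injective (tensor_map idfun f : tensor T L -> tensor T L').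
Proof.
move=> ij inj t u tu.
have iZ : forall a v, i (a *: v) = id a *: i v by move=> a v; exact: linearZ.
have jZ : forall a v, j (a *: v) = id a *: j v by move=> a v; exact: linearZ.
have fZ : forall a v, f (a *: v) = id a *: f v by move=> a v; exact: linearZ.
have retr (v : tensor T L) :
    tensor_map j idfun (tensor_map i idfun v : tensor T' L) = v.
  rewrite (@tensor_map_comp _ _ _ id id _ _ _ _ _ _ i idfun j idfun) //.
  by rewrite -[RHS]tensor_map_id; apply: eq_tensor_map.
have swap (v : tensor T L) :
    tensor_map idfun f (tensor_map i idfun v : tensor T' L) =
    tensor_map i idfun (tensor_map idfun f v : tensor T L').
  rewrite (@tensor_map_comp _ _ _ id id _ _ _ _ _ _ i idfun idfun f) //.
  by rewrite (@tensor_map_comp _ _ _ id id _ _ _ _ _ _ idfun f i idfun).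
by rewrite -[t]retr -[u]retr; congr tensor_map; apply: inj; rewrite !swap tu.
Qed.

(** * Injectivity on sections and on stalks *)

Section InjectiveStalks.
Context {X : topologicalType} {O : ring_presheaf X} {M N : mod_presheaf O}.
Variable f : mod_hom M N.

Lemma stalk_map_inj x :
  (forall U s, f U s = 0 -> s = 0) -> injective (stalk_map f x).
Proof.
move=> f0; apply: raddf_inj => a; have [U [Ux [s ->]]] := mgermP a.
rewrite /= stalk_mapE -(raddf0 (mgerm Ux)).
move=> /mgerm_eq[W [WU [WU' [Wx]]]]; rewrite raddf0 hmap_nat => /f0 e.
by rewrite -(mgerm_res WU Ux Wx) e raddf0.
Qed.

(** A section of a sheafification is a family of germs, so injectivity on
stalks gives injectivity on sections. Conversely, a germ killed by [f] has a
representative [s] over a neighbourhood with [f s = 0], and the family of all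
germs of [s] is then a section killed by the sheafified map. *)
Lemma mono_sheafifyP :
  mono_exact (sheafify_map f) <-> forall x, injective (stalk_map f x).
Proof.
split=> [f0 x|finj U s s0]; last first.
  apply: lsec_eq => x Ux; apply: (finj x).
  exact: etrans (congr1 (fun t : shf_sec N U => lval t Ux) s0)
    (esym (raddf0 (stalk_map f x))).
apply: raddf_inj => a; have [U [Ux [s ->]]] := mgermP a.
rewrite /= stalk_mapE -(raddf0 (mgerm Ux)).
move=> /mgerm_eq[W [WU [WU' [Wx]]]]; rewrite raddf0 hmap_nat => fs0.
have germsP : locally (germ_pred M) (fun y (Wy : W y) => mgerm Wy (mres WU s)).
  move=> y Wy; exists W, (@subset_refl _ _); split=> //.
  by exists (mres WU s) => z Wz; congr (mgerm _ _); exact: Prop_irrelevance.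
have s0 : (LSec germsP : sheafify M W) = 0.
  by apply: f0; apply: lsec_eq => y Wy; rewrite /= stalk_mapE fs0 raddf0.
rewrite -(mgerm_res WU Ux Wx).
exact: (congr1 (fun t : shf_sec M W => lval t Wx) s0).
Qed.

End InjectiveStalks.

(** * The stalk of a tensor product *)

Section StalkTensor.
Context {X : topologicalType} {O : ring_presheaf X}.
Context (M N : mod_presheaf O) (x : X).

Definition stalk_tprod (m : mstalk M x) (n : mstalk N x) :
    mstalk (tensor_presheaf M N) x :=
  @stalk_op2 _ (mod_ab M) (mod_ab N) (mod_ab (tensor_presheaf M N))
    (fun U (m : M U) (n : N U) => tprod m n) x m n.

Lemma stalk_tprodE (U : opens X) (Ux : U x) (m : M U) (n : N U) :
  stalk_tprod (mgerm Ux m) (mgerm Ux n) =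
  mgerm (M := tensor_presheaf M N) Ux (tprod m n).
Proof.
apply: (@stalk_op2E _ (mod_ab M) (mod_ab N) (mod_ab (tensor_presheaf M N))
  (fun U (m : M U) (n : N U) => tprod m n)).
by move=> V W h s t; exact: tensor_res_prod.
Qed.

Lemma stalk_tprodDl m m' n :
  stalk_tprod (m + m') n = stalk_tprod m n + stalk_tprod m' n.
Proof.
have [U [Ux [s [s' [t [-> -> ->]]]]]] :=
  germP3 (P := mod_ab M) (Q := mod_ab M) (S := mod_ab N) m m' n.
rewrite -!/(mgerm Ux _) -raddfD !stalk_tprodE tprodDl.
exact: (raddfD (mgerm (M := tensor_presheaf M N) Ux)).
Qed.

Lemma stalk_tprodDr m n n' :
  stalk_tprod m (n + n') = stalk_tprod m n + stalk_tprod m n'.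
Proof.
have [U [Ux [s [t [t' [-> -> ->]]]]]] :=
  germP3 (P := mod_ab M) (Q := mod_ab N) (S := mod_ab N) m n n'.
rewrite -!/(mgerm Ux _) -raddfD !stalk_tprodE tprodDr.
exact: (raddfD (mgerm (M := tensor_presheaf M N) Ux)).
Qed.

Lemma stalk_tprodZ a m n : stalk_tprod (a *: m) n = stalk_tprod m (a *: n).
Proof.
have [U [Ux [c [s [t [-> -> ->]]]]]] :=
  germP3 (P := ring_ab O) (Q := mod_ab M) (S := mod_ab N) a m n.
by rewrite -!/(mgerm Ux _) -!/(rgerm Ux _) -!mgermZ !stalk_tprodE tprodZ.
Qed.

Definition stalk_tensor :
    tensor (mstalk M x) (mstalk N x) -> mstalk (tensor_presheaf M N) x :=
  tensor_lift stalk_tprod.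

Definition tensor_germ (U : opens X) (Ux : U x) :
    tensor (M U) (N U) -> tensor (mstalk M x) (mstalk N x) :=
  tensor_map (mgerm Ux) (mgerm Ux).

Lemma tensor_germ0 (U : opens X) (Ux : U x) : tensor_germ Ux 0 = 0.
Proof. exact: tensor_map0 (mgermZ Ux) (mgermZ Ux). Qed.

Lemma tensor_germ_prodD (U : opens X) (Ux : U x) m n t :
  tensor_germ Ux (tprod m n + t) =
  tprod (mgerm Ux m) (mgerm Ux n) + tensor_germ Ux t.
Proof.
rewrite /tensor_germ (tensor_mapD (mgermZ Ux) (mgermZ Ux)).
by rewrite (tensor_map_prod (mgermZ Ux) (mgermZ Ux)).
Qed.

Lemma tensor_germ_res (U V : opens X) (VU : V `<=` U) (Ux : U x) (Vx : V x) t :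
  tensor_germ Vx (tensor_res VU t) = tensor_germ Ux t.
Proof.
rewrite /tensor_germ /tensor_res.
rewrite (tensor_map_comp (mresZ VU) (mresZ VU) (mgermZ Vx) (mgermZ Vx)).
by apply: eq_tensor_map => m /=; exact: mgerm_res.
Qed.

(** The finitely many germs occurring in a tensor have representatives on a
common neighbourhood. *)
Lemma tensor_germP (t : tensor (mstalk M x) (mstalk N x)) :
  exists (U : opens X) (Ux : U x) (u : tensor (M U) (N U)),
    t = tensor_germ Ux u.
Proof.
move: t; apply: tensor_ind => [|m n _ [U [Ux [u ->]]]].
  by exists (@Opens X setT openT), Logic.I, 0; rewrite tensor_germ0.
have [V [Vx [s [s' [-> ->]]]]] :=
  germP2 (P := mod_ab M) (Q := mod_ab N) m n.
rewrite -!/(mgerm Vx _).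
exists (opensI V U), (conj Vx Ux),
  (tprod (mres (@opensIl _ V U) s) (mres (@opensIl _ V U) s') +
   tensor_res (@opensIr _ V U) u).
rewrite tensor_germ_prodD (tensor_germ_res (@opensIr _ V U) Ux).
by rewrite !(mgerm_res (@opensIl _ V U) Vx).
Qed.

Lemma stalk_tensorE (U : opens X) (Ux : U x) (t : tensor (M U) (N U)) :
  stalk_tensor (tensor_germ Ux t) = mgerm (M := tensor_presheaf M N) Ux t.
Proof.
have lift0 := tensor_lift0 stalk_tprodDl stalk_tprodDr stalk_tprodZ.
have liftD := tensor_lift_prodD stalk_tprodDl stalk_tprodDr stalk_tprodZ.
move: t; apply: tensor_ind => [|m n t IH].
  rewrite tensor_germ0 /stalk_tensor lift0.
  by symmetry; exact: (raddf0 (mgerm (M := tensor_presheaf M N) Ux)).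
rewrite tensor_germ_prodD /stalk_tensor liftD -/(stalk_tensor _) IH stalk_tprodE.
by symmetry; exact: (raddfD (mgerm (M := tensor_presheaf M N) Ux)).
Qed.

(** Injectivity: if [u] and [u'] have the same germ in the stalk of the presheaf
tensor product, they agree as tensors over a smaller neighbourhood, hence also
after taking germs factor by factor. *)
Lemma stalk_tensor_inj : injective stalk_tensor.
Proof.
move=> t t'; have [U [Ux [u ->]]] := tensor_germP t.
have [V [Vx [v ->]]] := tensor_germP t'.
rewrite !stalk_tensorE => /mgerm_eq[W [WU [WV [Wx e]]]].
rewrite -(tensor_germ_res WU Ux Wx) -(tensor_germ_res WV Vx Wx).
by congr tensor_germ; exact: e.
Qed.

Lemma stalk_tensor_surj a : exists t, stalk_tensor t = a.
Proof.
have [U [Ux [t ->]]] := mgermP a.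
by exists (tensor_germ Ux t); exact: stalk_tensorE.
Qed.

End StalkTensor.

Section StalkTensorMap.
Context {X : topologicalType} {O : ring_presheaf X}.
Context (M : mod_presheaf O) {F G : mod_presheaf O} (tau : mod_hom F G) (x : X).

Lemma stalk_tensor_nat (t : tensor (mstalk M x) (mstalk F x)) :
  stalk_map (id_tensor_pre M tau) x (stalk_tensor t) =
  stalk_tensor (tensor_map idfun (stalk_map tau x) t : tensor (mstalk M x) (mstalk G x)).
Proof.
have [U [Ux [u ->]]] := tensor_germP t.
rewrite stalk_tensorE stalk_mapE -stalk_tensorE; congr stalk_tensor.
rewrite /tensor_germ.
have tauZ : forall a v, tau U (a *: v) = id a *: tau U v.
  by move=> a v; exact: linearZ.
have stZ : forall a v, stalk_map tau x (a *: v) = id a *: stalk_map tau x v.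
  by move=> a v; exact: linearZ.
rewrite /= /id_tensor_sec.
rewrite (@tensor_map_comp _ _ _ id _ _ _ _ _ _ _ idfun (tau U) (mgerm Ux)
  (mgerm Ux) _ tauZ (mgermZ Ux) (mgermZ Ux)) //.
rewrite (@tensor_map_comp _ _ _ _ id _ _ _ _ _ _ (mgerm Ux) (mgerm Ux) idfun
  (stalk_map tau x) (mgermZ Ux) (mgermZ Ux) _ stZ) //.
by apply: eq_tensor_map => m //=; rewrite stalk_mapE.
Qed.

Lemma stalk_id_tensor_injP :
  injective (stalk_map (id_tensor_pre M tau) x) <->
  injective (tensor_map idfun (stalk_map tau x) :
    tensor (mstalk M x) (mstalk F x) -> tensor (mstalk M x) (mstalk G x)).
Proof.
split=> inj.
  move=> t u e; apply/stalk_tensor_inj/inj.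
  by rewrite !stalk_tensor_nat e.
move=> a b; have [t <-] := stalk_tensor_surj a.
have [u <-] := stalk_tensor_surj b.
by rewrite !stalk_tensor_nat => /stalk_tensor_inj/inj ->.
Qed.

End StalkTensorMap.

(** * Skyscraper sheaves *)

Section Skyscraper.
Context {X : topologicalType} {O : ring_presheaf X} (x : X).
Context (T : lmodType (rstalk O x)).

(** Functions on the proofs of [U x]: this is a copy of [T] if [x] lies in [U]
and a one-element module otherwise, with no case distinction. *)
Definition sky_sec (U : opens X) : Type := U x -> T.

HB.instance Definition _ U := gen_eqMixin (sky_sec U).
HB.instance Definition _ U := gen_choiceMixin (sky_sec U).

Section Module.
Variable U : opens X.

Let sky_addA : associative (fun (s t : sky_sec U) Ux => s Ux + t Ux).
Proof. by move=> s t u; apply/funext => Ux; rewrite addrA. Qed.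

Let sky_addC : commutative (fun (s t : sky_sec U) Ux => s Ux + t Ux).
Proof. by move=> s t; apply/funext => Ux; rewrite addrC. Qed.

Let sky_add0 : left_id (fun=> 0) (fun (s t : sky_sec U) Ux => s Ux + t Ux).
Proof. by move=> s; apply/funext => Ux; rewrite add0r. Qed.

Let sky_addN : left_inverse (fun=> 0) (fun (s : sky_sec U) Ux => - s Ux)
  (fun (s t : sky_sec U) Ux => s Ux + t Ux).
Proof. by move=> s; apply/funext => Ux; rewrite addNr. Qed.

HB.instance Definition _ := GRing.isZmodule.Build (sky_sec U)
  sky_addA sky_addC sky_add0 sky_addN.

Definition sky_scale (a : O U) (s : sky_sec U) : sky_sec U :=
  fun Ux => rgerm Ux a *: s Ux.

Let sky_scaleA a b s : sky_scale a (sky_scale b s) = sky_scale (a * b) s.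
Proof. by apply/funext => Ux; rewrite /sky_scale scalerA rmorphM. Qed.

Let sky_scale1 : left_id 1 sky_scale.
Proof. by move=> s; apply/funext => Ux; rewrite /sky_scale rmorph1 scale1r. Qed.

Let sky_scaleDr : right_distributive sky_scale +%R.
Proof. by move=> a s t; apply/funext => Ux; exact: scalerDr. Qed.

Let sky_scaleDl s : {morph sky_scale^~ s : a b / a + b}.
Proof.
by move=> a b; apply/funext => Ux; rewrite /sky_scale raddfD; exact: scalerDl.
Qed.

HB.instance Definition _ := GRing.Zmodule_isLmodule.Build (O U) (sky_sec U)
  sky_scaleA sky_scale1 sky_scaleDr sky_scaleDl.

End Module.

Definition sky_res (U V : opens X) (h : V `<=` U) (s : sky_sec U) : sky_sec V :=
  fun Vx => s (h x Vx).

Let sky_res_additive (U V : opens X) (h : V `<=` U) : zmod_morphism (sky_res h).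
Proof. by []. Qed.

HB.instance Definition _ (U V : opens X) (h : V `<=` U) :=
  GRing.isZmodMorphism.Build _ _ (sky_res h) (sky_res_additive h).

Lemma sky_irr (U : opens X) (s : sky_sec U) (Ux Ux' : U x) : s Ux = s Ux'.
Proof. by congr s; exact: Prop_irrelevance. Qed.

Let sky_resZ (U V : opens X) (h : V `<=` U) (a : O U) (s : sky_sec U) :
  sky_res h (a *: s) = rres h a *: sky_res h s.
Proof.
apply/funext => Vx; rewrite [RHS]/(rgerm Vx (rres h a) *: s (h x Vx)).
by rewrite (rgerm_res h (h x Vx)).
Qed.

Let sky_res_id (U : opens X) (h : U `<=` U) (s : sky_sec U) : sky_res h s = s.
Proof. by apply/funext => Ux; exact: (@sky_irr U s). Qed.

Let sky_res_comp (U V W : opens X) (hVU : V `<=` U) (hWV : W `<=` V)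
  (hWU : W `<=` U) (s : sky_sec U) : sky_res hWV (sky_res hVU s) = sky_res hWU s.
Proof. by apply/funext => Wx; exact: (@sky_irr U s). Qed.

Definition sky_pre : mod_presheaf O :=
  @ModPresheaf X O sky_sec (fun U V h => sky_res h)
    sky_resZ sky_res_id sky_res_comp.

Let sky_sheafP : is_sheaf (mod_ab sky_pre).
Proof.
move=> V I U UV cov s sE.
have sEx i j (Ui : U i x) (Uj : U j x) : (s i : sky_sec _) Ui = (s j : sky_sec _) Uj.
  have := congr1 (fun t : sky_sec (opensI (U i) (U j)) => t (conj Ui Uj)) (sE i j).
  by rewrite /= /sky_res (sky_irr _ _ Ui) (sky_irr _ _ Uj).
have idx (Vx : V x) : {i | U i x}.
  by apply: cid; have [i _ Ux] := cov x Vx; exists i.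
exists ((fun Vx => (s (projT1 (idx Vx)) : sky_sec _) (projT2 (idx Vx))) : sky_sec V).
split=> [i|t tE]; apply/funext; first by move=> Ux; exact: sEx.
by move=> Vx; rewrite -tE; exact: (@sky_irr V t).
Qed.

Definition skyscraper : mod_sheaf O := ModSheaf sky_sheafP.

Definition sky_germ (v : T) : mstalk skyscraper x :=
  @mgerm X O skyscraper x (@Opens X setT openT) Logic.I (fun=> v).

Definition sky_val (m : mstalk skyscraper x) : T :=
  (gsec (stalk_repr m) : sky_sec _) (gmem (stalk_repr m)).

Lemma sky_valE (U : opens X) (Ux : U x) (s : sky_sec U) :
  sky_val (mgerm (M := skyscraper) Ux s) = s Ux.
Proof.
rewrite /sky_val; set g := stalk_repr _.
have /germ_eq[W [Wg [WU [Wx e]]]] :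
    germ (gmem g) (gsec g) = mgerm (M := skyscraper) Ux s by exact: stalk_reprK.
have := congr1 (fun t : sky_sec W => t Wx) e.
by rewrite /= /sky_res (sky_irr _ _ (gmem g)) (sky_irr _ _ Ux).
Qed.

Lemma sky_germE (U : opens X) (Ux : U x) (v : T) :
  sky_germ v = mgerm (M := skyscraper) Ux (fun=> v).
Proof. by apply/mgerm_eq; exists U, (fun _ _ => Logic.I), (@subset_refl _ _). Qed.

Lemma skyscraper_germK : cancel sky_germ sky_val.
Proof. by move=> v; exact: sky_valE. Qed.

Let sky_germ_additive : zmod_morphism sky_germ.
Proof.
move=> v w; rewrite /sky_germ.
by rewrite -(raddfB (@mgerm X O skyscraper x (@Opens X setT openT) Logic.I)).
Qed.

Let sky_germ_scalable : scalable sky_germ.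
Proof.
move=> a v; have [U [Ux [c ->]]] := rgermP a.
rewrite !(sky_germE Ux) -mgermZ; congr (mgerm _ _).
by apply/funext => Ux'; rewrite (Prop_irrelevance Ux Ux').
Qed.

HB.instance Definition _ :=
  GRing.isZmodMorphism.Build _ _ sky_germ sky_germ_additive.
HB.instance Definition _ :=
  GRing.isScalable.Build _ _ _ _ sky_germ sky_germ_scalable.

Let sky_val_additive : zmod_morphism sky_val.
Proof.
move=> m n; have [U [Ux [s [t [-> ->]]]]] :=
  germP2 (P := mod_ab skyscraper) (Q := mod_ab skyscraper) m n.
by rewrite -!/(mgerm Ux _) -raddfB !sky_valE.
Qed.

Let sky_val_scalable : scalable sky_val.
Proof.
move=> a m; have [U [Ux [c [s [-> ->]]]]] :=
  germP2 (P := ring_ab O) (Q := mod_ab skyscraper) a m.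
by rewrite -!/(mgerm Ux _) -!/(rgerm Ux _) -mgermZ !sky_valE.
Qed.

HB.instance Definition _ :=
  GRing.isZmodMorphism.Build _ _ sky_val sky_val_additive.
HB.instance Definition _ :=
  GRing.isScalable.Build _ _ _ _ sky_val sky_val_scalable.

End Skyscraper.

(** * Purity and stalks *)

Theorem proposition3p2 (X : scheme) (F G : mod_sheaf (rs_sheaf X))
    (tau : mod_hom F G) (tau_exact : mono_exact tau) :
  pure_exact tau <-> (forall x : X, pure_mono (stalk_map tau x)).
Proof.
split=> [[_ pure] x|pure]; last first.
  split=> // M; apply/mono_sheafifyP => x; apply/stalk_id_tensor_injP.
  by have [_ inj] := pure x; exact: inj.
split=> [|T]; first exact: stalk_map_inj.
apply: (tensor_inj_retract (@skyscraper_germK _ _ x T)).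
have /mono_sheafifyP inj := pure (skyscraper T).
exact: (stalk_id_tensor_injP (skyscraper T) tau x).1 (inj x).
Qed.
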